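(* Let $I$ be a non-empty set, let $E$ be a Banach sequence lattice on $I$ with $C_E<\infty$, and let $B$ be a Banach algebra. Let $B^{(E)}:=\bigl(\bigoplus_{i\in I}B\bigr)_E$ be the $E$-sum of the constant family $A_i=B$ ($i\in I$). Then $B^{(E)}$ is amenable if and only if $B$ is amenable. Moreover, $$\mathrm{AM}(B)\ \le\ \mathrm{AM}\bigl(B^{(E)}\bigr)\ \le\ C_E^2\,\mathrm{AM}(B).$$ In the particular case $E=c_0(I)$ (with the supremum norm) one has the exact identity $\mathrm{AM}(B^{(c_0)})=\mathrm{AM}(B)$.
   Context: All Banach spaces and algebras are complex. $c_{00}(I)$ denotes the finitely supported complex functions on $I$, and $\chi_F$ the characteristic function of $F\subseteq I$. $C_E:=\sup\{\|\chi_F\|_E: F\subseteq I\text{ finite}\}$. Amenability constant. For a Banach algebra $A$, $A\widehat{\otimes}A$ is the projective tensor product, $\pi\colon A\widehat{\otimes}A\to A$ is the product map $\pi(a\otimes b)=ab$, and $A\widehat{\otimes}A$ is an $A$-bimodule via $a\cdot(x\otimes y)=(ax)\otimes y$, $(x\otimes y)\cdot a=x\otimes(ya)$; the actions extend canonically to $(A\widehat{\otimes}A)^{**}$. A virtual diagonal for $A$ is $M\in(A\widehat{\otimes}A)^{**}$ with $a\cdot M=M\cdot a$ and $a\cdot\pi^{**}(M)=a=\pi^{**}(M)\cdot a$ for all $a\in A$. $A$ is amenable if it has a virtual diagonal; then $\mathrm{AM}(A):=\inf\{\|M\|: M \text{ a virtual diagonal for } A\}$, and $\mathrm{AM}(A):=+\infty$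 if $A$ is not amenable. Banach sequence lattice. A Banach sequence lattice on $I$ is a Banach space $E$ of complex-valued functions on $I$ such that (a) $c_{00}(I)\subseteq E\subseteq\ell_\infty(I)$ and $c_{00}(I)$ is dense in $E$; (b) $E$ is solid: if $y\in E$, $x\in\ell_\infty(I)$ and $|x_i|\le|y_i|$ for all $i$, then $x\in E$ and $\|x\|_E\le\|y\|_E$; (c) $\|x\|_\infty\le\|x\|_E$ for all $x\in E$. $E$-sum. $\bigl(\bigoplus_{i\in I}A_i\bigr)_E$ is the Banach algebra of all families $a=(a_i)_{i\in I}$, $a_i\in A_i$, with $(\|a_i\|)_{i\in I}\in E$, with norm $\|a\|=\|(\|a_i\|)_{i\in I}\|_E$ and coordinatewise multiplication. *)

(* Defs.v *)
From HB Require Import structures.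
From mathcomp Require Import all_boot all_order all_algebra.
From mathcomp Require Import generic_quotient complex.
From mathcomp Require Import all_classical all_reals all_analysis.

Set Implicit Arguments.
Unset Strict Implicit.
Unset Printing Implicit Defensive.

Import Order.TTheory GRing.Theory Num.Theory.
Import numFieldNormedType.Exports.

Local Open Scope classical_set_scope.
Local Open Scope complex_scope.
Local Open Scope ring_scope.

(* The library norm of a normed module over R[i] takes its values in R[i];
   nrm is the same norm seen as a real number. *)
Section RealNorm.
Variables (R : realType).

Definition nrm (V : normedModType R[i]) (x : V) : R := complex.Re `|x|.

Variable V : normedModType R[i].
Implicit Types x y : V.

Lemma nrmE x : `|x| = (nrm x)%:C.
Proof. by rewrite /nrm RRe_real // ger0_real. Qed.

Lemma nrm_ge0 x : 0 <= nrm x.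
Proof. by rewrite -ler0c -nrmE. Qed.

Lemma ler_nrmD x y : nrm (x + y) <= nrm x + nrm y.
Proof. by rewrite -lecR rmorphD /= -!nrmE ler_normD. Qed.

Lemma nrmZ (c : R[i]) x : nrm (c *: x) = nrm (c : R[i]^o) * nrm x.
Proof. by apply: (@complexI R); rewrite rmorphM /= -!nrmE normrZ. Qed.

Lemma nrm0 : nrm (0 : V) = 0.
Proof. by apply: (@complexI R); rewrite -nrmE normr0. Qed.

Lemma nrm0_eq0 x : nrm x = 0 -> x = 0.
Proof. by move=> x0; apply/normr0_eq0; rewrite nrmE x0. Qed.

Lemma nrmN x : nrm (- x) = nrm x.
Proof. by apply: (@complexI R); rewrite -!nrmE normrN. Qed.

Lemma nrm_distC x y : nrm (x - y) = nrm (y - x).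
Proof. by rewrite -nrmN opprB. Qed.

Lemma ler_nrm_dist x y : `|nrm x - nrm y| <= nrm (x - y).
Proof.
rewrite ler_norml; apply/andP; split.
  by rewrite lerNl opprB lerBlDr nrm_distC -{1}(subrK x y) ler_nrmD.
by rewrite lerBlDr -{1}(subrK y x) ler_nrmD.
Qed.

End RealNorm.

Lemma nrm_real (R : realType) (r : R) : 0 <= r -> nrm (r%:C : R[i]^o) = r.
Proof.
by move=> r0; apply: (@complexI R); rewrite -nrmE ger0_norm // ler0c.
Qed.

Section Sequences.
Variable R : realType.

(* Cauchy and convergent sequences for a real-valued (semi)norm p. *)
Definition cauchy_for (V : zmodType) (p : V -> R) (u : nat -> V) :=
  forall e : R, 0 < e ->
    exists N, forall m n, (N <= m)%N -> (N <= n)%N -> p (u m - u n) < e.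

Definition cvg_for (V : zmodType) (p : V -> R) (u : nat -> V) (l : V) :=
  forall e : R, 0 < e -> exists N, forall n, (N <= n)%N -> p (u n - l) < e.

Definition harm (n : nat) : R := n.+1%:R^-1.

Lemma harm_gt0 n : 0 < harm n. Proof. by rewrite invr_gt0. Qed.

Lemma harm_small (e : R) : 0 < e -> exists N, forall n, (N <= n)%N -> harm n < e.
Proof.
move=> e0; exists (Num.truncn e^-1) => n Nn; rewrite /harm.
rewrite -[ltRHS]invrK ltf_pV2 ?posrE ?invr_gt0 //.
apply: lt_le_trans (truncnS_gt _) _; by rewrite ler_nat.
Qed.

Lemma cauchy_seq_complete (V : normedModType R[i]) :
  (forall u : nat -> V, cauchy_for (@nrm R V) u ->
     exists l, cvg_for (@nrm R V) u l) ->
  forall F : set_system V, ProperFilter F -> cauchy F -> cvg F.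
Proof.
move=> compl F FF /cauchy_ballP Fc.
have /choice[x Fx] : forall n, exists x : V, F (ball x (harm n)%:C).
  move=> n; have h0 : (0 : R[i]) < (harm n)%:C by rewrite ltcR harm_gt0.
  by have /cauchy_ballP/cauchyP/(_ _ h0) := Fc.
have dxF n y : ball (x n) (harm n)%:C y -> nrm (x n - y) < harm n.
  by rewrite -ball_normE /= nrmE ltcR.
have [|l xl] := compl x.
  move=> e e0; have e20 : 0 < e / 2 by rewrite divr_gt0.
  have [N HN] := harm_small e20; exists N => m n Nm Nn.
  have [y [/dxF ym /dxF yn]] := filter_ex (filterI (Fx m) (Fx n)).
  rewrite -(subrKA y) [ltRHS]splitr; apply: le_lt_trans (ler_nrmD _ _) _.
  apply: ltrD; first exact: lt_trans ym (HN _ Nm).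
  by rewrite nrm_distC; exact: lt_trans yn (HN _ Nn).
apply/cvg_ex; exists l; apply/cvgrPdist_lt => /= e e0.
have [r re] : exists r, e = r%:C.
  by exists (complex.Re e); rewrite RRe_real // gtr0_real.
have r0 : 0 < r by move: e0; rewrite re ltcR.
have r20 : 0 < r / 2 by rewrite divr_gt0.
have [N HN] := harm_small r20; have [N' HN'] := xl _ r20.
pose n := maxn N N'.
apply: filterS (Fx n) => y /dxF yn.
rewrite re nrmE ltcR -(subrKA (x n)) [ltRHS]splitr.
apply: le_lt_trans (ler_nrmD _ _) _; apply: ltrD.
  by rewrite nrm_distC HN' // leq_maxr.
by apply: lt_trans yn _; rewrite HN // leq_maxl.
Qed.

End Sequences.

Section Limits.
Variable R : realType.

Lemma real_cauchy_cvg (u : nat -> R) :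
  (forall e, 0 < e -> exists N, forall m n, (N <= m)%N -> (N <= n)%N ->
     `|u m - u n| < e) -> cvg (u @ \oo).
Proof.
move=> uc; apply: cauchy_cvg; apply/cauchy_ballP => e e0 /=.
have [N HN] := uc e e0.
exists ([set u n | n in [set n | (N <= n)%N]],
        [set u n | n in [set n | (N <= n)%N]]) => /=.
  split; exists N => // n /= Nn; by exists n.
by move=> [x y] /= [[m Nm <-] [n Nn <-]]; rewrite /ball /=; exact: HN.
Qed.

Variable V : normedModType R[i].

Lemma cvg_forP (u : nat -> V) l :
  (u @ \oo --> l) <-> cvg_for (@nrm R V) u l.
Proof.
split.
  move=> ul e e0; have e0' : (0 : R[i]) < e%:C by rewrite ltcR.
  have [N _ HN] := iffLR (cvgrPdist_lt _ _) ul _ e0'.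
  by exists N => n /HN; rewrite nrmE ltcR nrm_distC.
move=> ul; apply/cvgrPdist_lt => e e0.
have er : (complex.Re e)%:C = e by rewrite RRe_real // gtr0_real.
have [|N HN] := ul (complex.Re e); first by rewrite -ltcR er.
by exists N => // n /HN; rewrite -er nrmE ltcR nrm_distC.
Qed.

Lemma cvg_for_uniq (u : nat -> V) l l' :
  cvg_for (@nrm R V) u l -> cvg_for (@nrm R V) u l' -> l = l'.
Proof. by move=> /cvg_forP ul /cvg_forP; apply: (cvg_unique _ ul). Qed.

Lemma cvg_nrm (u : nat -> V) l :
  u @ \oo --> l -> (fun n => nrm (u n)) @ \oo --> nrm l.
Proof.
move/cvg_forP => ul; apply/cvgrPdist_lt => e e0.
have [N HN] := ul e e0; exists N => // n /= Nn.
by rewrite distrC; apply: le_lt_trans (ler_nrm_dist _ _) (HN _ Nn).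
Qed.

End Limits.

Lemma cauchy_for_cvg (R : realType) (V : completeNormedModType R[i])
  (u : nat -> V) : cauchy_for (@nrm R V) u -> cvg (u @ \oo).
Proof.
move=> uc; apply: cauchy_cvg; apply/cauchy_ballP => e e0 /=.
have er : (complex.Re e)%:C = e by rewrite RRe_real // gtr0_real.
have [|N HN] := uc (complex.Re e); first by rewrite -ltcR er.
exists ([set u n | n in [set n | (N <= n)%N]],
        [set u n | n in [set n | (N <= n)%N]]) => /=.
  split; exists N => // n /= Nn; by exists n.
move=> [x y] /= [[m Nm <-] [n Nn <-]].
by rewrite -ball_normE /= -er nrmE ltcR; exact: HN.
Qed.

Section ComplexComplete.
Variable R : realType.

Lemma nrm_Re (z : R[i]^o) : `|complex.Re z| <= nrm z.
Proof. by rewrite -lecR -nrmE; exact: normc_ge_Re. Qed.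

Lemma nrm_Im (z : R[i]^o) : `|complex.Im z| <= nrm z.
Proof.
rewrite -lecR -nrmE; case: z => a b /=; rewrite normc_def /= lecR.
by rewrite -sqrtr_sqr ler_wsqrtr // lerDr sqr_ge0.
Qed.

Lemma nrm_le_ReIm (z : R[i]^o) :
  nrm z <= `|complex.Re z| + `|complex.Im z|.
Proof.
rewrite -lecR -nrmE {1}(complexE z); apply: le_trans (ler_normD _ _) _.
rewrite !normc_def /= !mul0r !mul1r ?sub0r ?subr0 ?oppr0 ?add0r ?addr0 expr0n /= ?addr0 ?add0r.
by rewrite !sqrtr_sqr -rmorphD.
Qed.

Lemma complex_complete (u : nat -> R[i]^o) :
  cauchy_for (@nrm R R[i]^o) u -> exists l, cvg_for (@nrm R R[i]^o) u l.
Proof.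
move=> uc.
have [a ua] : exists a : R, (fun n => complex.Re (u n)) @ \oo --> a.
  apply/cvg_ex; apply: real_cauchy_cvg => e /uc[N HN]; exists N => m n Nm Nn.
  by apply: le_lt_trans (HN m n Nm Nn); rewrite -raddfB; exact: nrm_Re.
have [b ub] : exists b : R, (fun n => complex.Im (u n)) @ \oo --> b.
  apply/cvg_ex; apply: real_cauchy_cvg => e /uc[N HN]; exists N => m n Nm Nn.
  by apply: le_lt_trans (HN m n Nm Nn); rewrite -raddfB; exact: nrm_Im.
exists (a +i* b) => e e0; have e20 : 0 < e / 2 by rewrite divr_gt0.
have [N _ HN] := iffLR (cvgrPdist_lt _ _) ua _ e20.
have [M _ HM] := iffLR (cvgrPdist_lt _ _) ub _ e20.
exists (maxn N M) => n; rewrite geq_max => /andP[Nn Mn].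
apply: le_lt_trans (nrm_le_ReIm _) _; rewrite [ltRHS]splitr.
apply: ltrD.
  by rewrite raddfB /= distrC; exact: HN.
by rewrite raddfB /= distrC; exact: HM.
Qed.


End ComplexComplete.

(* Bounded linear maps V -> W with the operator norm. *)
Section BoundedLinear.
Variable R : realType.

Record blin (V W : normedModType R[i]) := Blin {
  blin_fun :> V -> W;
  blin_linear : linear blin_fun;
  blin_bounded : exists M : R, forall x, nrm (blin_fun x) <= M * nrm x }.

HB.instance Definition _ V W (T : blin V W) :=
  GRing.isLinear.Build R[i] V W *:%R (blin_fun T) (blin_linear T).

Variables V W : normedModType R[i].
Implicit Types S T : blin V W.

Lemma blin_ext S T : (forall x, S x = T x) -> S = T.
Proof.
case: S T => [s ls bs] [t lt bt] /= /funext st; subst t.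
by rewrite (Prop_irrelevance ls lt) (Prop_irrelevance bs bt).
Qed.

HB.instance Definition _ := gen_eqMixin (blin V W).
HB.instance Definition _ := gen_choiceMixin (blin V W).

Fact blin0_linear : linear (fun _ : V => 0 : W).
Proof. by move=> c x y; rewrite scaler0 addr0. Qed.
Fact blin0_bounded : exists M : R, forall x : V, nrm (0 : W) <= M * nrm x.
Proof. by exists 0 => x; rewrite nrm0 mul0r. Qed.
Definition blin0 := Blin blin0_linear blin0_bounded.

Fact blin_opp_linear T : linear (fun x => - T x).
Proof. by move=> c x y; rewrite linearP opprD scalerN. Qed.
Fact blin_opp_bounded T : exists M : R, forall x, nrm (- T x) <= M * nrm x.
Proof. by have [M TM] := blin_bounded T; exists M => x; rewrite nrmN. Qed.
Definition blin_opp T := Blin (blin_opp_linear T) (blin_opp_bounded T).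

Fact blin_add_linear S T : linear (fun x => S x + T x).
Proof. by move=> c x y; rewrite !linearP scalerDr addrACA. Qed.
Fact blin_add_bounded S T :
  exists M : R, forall x, nrm (S x + T x) <= M * nrm x.
Proof.
have [M SM] := blin_bounded S; have [N TN] := blin_bounded T.
by exists (M + N) => x; rewrite mulrDl (le_trans (ler_nrmD _ _)) ?lerD.
Qed.
Definition blin_add S T := Blin (blin_add_linear S T) (blin_add_bounded S T).

Fact blin_scale_linear (c : R[i]) T : linear (fun x => c *: T x).
Proof. by move=> d x y; rewrite linearP scalerDr !scalerA mulrC. Qed.
Fact blin_scale_bounded (c : R[i]) T :
  exists M : R, forall x, nrm (c *: T x) <= M * nrm x.
Proof.
have [M TM] := blin_bounded T; exists (nrm (c : R[i]^o) * M) => x.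
by rewrite nrmZ -mulrA ler_wpM2l ?nrm_ge0.
Qed.
Definition blin_scale c T := Blin (blin_scale_linear c T) (blin_scale_bounded c T).

Fact blin_addA : associative blin_add.
Proof. by move=> S T U; apply: blin_ext => x /=; rewrite addrA. Qed.
Fact blin_addC : commutative blin_add.
Proof. by move=> S T; apply: blin_ext => x /=; rewrite addrC. Qed.
Fact blin_add0 : left_id blin0 blin_add.
Proof. by move=> S; apply: blin_ext => x /=; rewrite add0r. Qed.
Fact blin_addN : left_inverse blin0 blin_opp blin_add.
Proof. by move=> S; apply: blin_ext => x /=; rewrite addNr. Qed.

HB.instance Definition _ := GRing.isZmodule.Build (blin V W)
  blin_addA blin_addC blin_add0 blin_addN.

Fact blin_scaleA c d T : blin_scale c (blin_scale d T) = blin_scale (c * d) T.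
Proof. by apply: blin_ext => x /=; rewrite scalerA. Qed.
Fact blin_scale1 : left_id 1 blin_scale.
Proof. by move=> S; apply: blin_ext => x /=; rewrite scale1r. Qed.
Fact blin_scaleDr : right_distributive blin_scale +%R.
Proof. by move=> c S T; apply: blin_ext => x /=; rewrite scalerDr. Qed.
Fact blin_scaleDl T : {morph blin_scale^~ T : c d / c + d}.
Proof. by move=> c d; apply: blin_ext => x /=; rewrite scalerDl. Qed.

HB.instance Definition _ := GRing.Zmodule_isLmodule.Build R[i] (blin V W)
  blin_scaleA blin_scale1 blin_scaleDr blin_scaleDl.

Definition opnorm T : R := sup [set nrm (T x) | x in [set x | nrm x <= 1]].

Lemma opnorm_has_sup T :
  has_sup [set nrm (T x) | x in [set x | nrm x <= 1]].
Proof.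
split; first by exists (nrm (T 0)); exists 0 => //=; rewrite nrm0.
have [M TM] := blin_bounded T; exists `|M| => _ [x /= x1 <-].
apply: le_trans (TM x) _; apply: le_trans (ler_norm _) _.
by rewrite normrM (ger0_norm (nrm_ge0 _)) ler_piMr.
Qed.

Lemma opnorm_ge0 T : 0 <= opnorm T.
Proof.
apply: le_trans (nrm_ge0 (T 0)) _.
by apply: ub_le_sup; [case: (opnorm_has_sup T)|exists 0 => //=; rewrite nrm0].
Qed.

Lemma ler_opnorm T x : nrm (T x) <= opnorm T * nrm x.
Proof.
have [->|x0] := eqVneq x 0; first by rewrite linear0 !nrm0 mulr0.
have nx : 0 < nrm x.
  by rewrite lt_def nrm_ge0 andbT; apply: contra_neq x0 => /nrm0_eq0.
rewrite -ler_pdivrMr //.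
have -> : nrm (T x) / nrm x = nrm (T ((nrm x)^-1%:C *: x)).
  by rewrite linearZ /= nrmZ nrm_real ?invr_ge0 ?nrm_ge0 // mulrC.
apply: ub_le_sup; first by case: (opnorm_has_sup T).
exists ((nrm x)^-1%:C *: x) => //=.
by rewrite nrmZ nrm_real ?invr_ge0 ?nrm_ge0 // mulVf // gt_eqF.
Qed.

Lemma opnorm_le T M : 0 <= M -> (forall x, nrm (T x) <= M * nrm x) ->
  opnorm T <= M.
Proof.
move=> M0 TM; apply: ge_sup; first by case: (opnorm_has_sup T).
move=> _ [x /= x1 <-]; apply: le_trans (TM x) _.
by rewrite ler_piMr.
Qed.

Lemma opnormD S T : opnorm (S + T) <= opnorm S + opnorm T.
Proof.
apply: opnorm_le; first by rewrite addr_ge0 ?opnorm_ge0.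
move=> x; rewrite mulrDl; apply: le_trans (ler_nrmD _ _) _.
by rewrite lerD ?ler_opnorm.
Qed.

Lemma opnormZ_le (c : R[i]) T : opnorm (c *: T) <= nrm (c : R[i]^o) * opnorm T.
Proof.
apply: opnorm_le; first by rewrite mulr_ge0 ?opnorm_ge0 ?nrm_ge0.
by move=> x; rewrite /= nrmZ -mulrA ler_wpM2l ?nrm_ge0 ?ler_opnorm.
Qed.

Lemma opnorm0_eq0 T : opnorm T = 0 -> T = 0.
Proof.
move=> T0; apply: blin_ext => x; apply: nrm0_eq0; apply: le_anti.
by rewrite nrm_ge0 andbT; have := ler_opnorm T x; rewrite T0 mul0r.
Qed.

Lemma opnormZ (c : R[i]) T : opnorm (c *: T) = nrm (c : R[i]^o) * opnorm T.
Proof.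
apply: le_anti; rewrite opnormZ_le /=.
have [->|c0] := eqVneq c 0; first by rewrite nrm0 mul0r opnorm_ge0.
have nc : 0 < nrm (c : R[i]^o).
  by rewrite lt_def nrm_ge0 andbT; apply: contra_neq c0 => /nrm0_eq0.
rewrite -ler_pdivlMl //.
have {1}-> : T = c^-1 *: (c *: T) by rewrite scalerA mulVf // scale1r.
apply: le_trans (opnormZ_le _ _) _; rewrite ler_wpM2r ?opnorm_ge0 //.
by rewrite -lecR -nrmE normfV nrmE fmorphV.
Qed.

Fact blin_normD S T : (opnorm (S + T))%:C <= (opnorm S)%:C + (opnorm T)%:C.
Proof. by rewrite -rmorphD lecR opnormD. Qed.
Fact blin_normZ (c : R[i]) T : (opnorm (c *: T))%:C = `|c| * (opnorm T)%:C.
Proof. by rewrite opnormZ rmorphM (nrmE (c : R[i]^o)). Qed.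
Fact blin_norm0_eq0 T : (opnorm T)%:C = 0 -> T = 0.
Proof. by move/(@complexI R)/opnorm0_eq0. Qed.

HB.instance Definition _ := Lmodule_isNormed.Build R[i] (blin V W)
  blin_normD blin_normZ blin_norm0_eq0.

Lemma nrm_blin T : nrm T = opnorm T.
Proof. by []. Qed.

End BoundedLinear.

Section Duality.
Variable R : realType.

Definition dual (V : normedModType R[i]) : normedModType R[i] := blin V R[i]^o.

Definition bidual (V : normedModType R[i]) : normedModType R[i] :=
  dual (dual V).

Section Adjoint.
Variables (V W : normedModType R[i]) (T : blin V W).

Fact pullback_linear (f : dual W) : linear (fun x => f (T x)).
Proof. by move=> c x y; rewrite !linearP. Qed.
Fact pullback_bounded (f : dual W) :
  exists M : R, forall x, nrm (f (T x)) <= M * nrm x.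
Proof.
exists (opnorm f * opnorm T) => x; apply: le_trans (ler_opnorm _ _) _.
by rewrite -mulrA ler_wpM2l ?opnorm_ge0 ?ler_opnorm.
Qed.
Definition pullback (f : dual W) : dual V :=
  Blin (pullback_linear f) (pullback_bounded f).

Fact adjoint_linear : linear pullback.
Proof. by move=> c f g; apply: blin_ext. Qed.
Fact adjoint_bounded : exists M : R, forall f, nrm (pullback f) <= M * nrm f.
Proof.
exists (opnorm T) => f; rewrite !nrm_blin; apply: opnorm_le.
  by rewrite mulr_ge0 ?opnorm_ge0.
move=> x; apply: le_trans (ler_opnorm f (T x)) _.
rewrite [opnorm T * _]mulrC -mulrA.
by rewrite ler_wpM2l ?opnorm_ge0 ?ler_opnorm.
Qed.
Definition adjoint : blin (dual W) (dual V) := Blin adjoint_linear adjoint_bounded.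

End Adjoint.

Definition biadjoint (V W : normedModType R[i]) (T : blin V W) :
  blin (bidual V) (bidual W) := adjoint (adjoint T).

Section Evaluation.
Variables (V : normedModType R[i]) (x : V).

Fact evaluation_linear : linear (fun f : dual V => f x).
Proof. by []. Qed.
Fact evaluation_bounded :
  exists M : R, forall f : dual V, nrm (f x) <= M * nrm f.
Proof. by exists (nrm x) => f; rewrite mulrC ler_opnorm. Qed.
(* The image of x under the canonical embedding of V into its bidual. *)
Definition evaluation : bidual V := Blin evaluation_linear evaluation_bounded.

End Evaluation.

End Duality.

(* The algebraic tensor product: a list [:: (x1, y1); ...; (xn, yn)] stands for
   the formal sum of the x_i (x) y_i; such sums are identified by the least
   congruence that makes (x, y) |-> x (x) y bilinear. *)
Inductive tens_eq (K : comNzRingType) (A B : lmodType K) :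
    seq (A * B) -> seq (A * B) -> Prop :=
| tens_eq_refl l : tens_eq l l
| tens_eq_sym l m : tens_eq l m -> tens_eq m l
| tens_eq_trans l m n : tens_eq l m -> tens_eq m n -> tens_eq l n
| tens_eq_cat l l' m m' :
    tens_eq l l' -> tens_eq m m' -> tens_eq (l ++ m) (l' ++ m')
| tens_eq_catC l m : tens_eq (l ++ m) (m ++ l)
| tens_eq_0 y : tens_eq [:: (0, y)] [::]
| tens_eq_addl x x' y : tens_eq [:: (x + x', y)] [:: (x, y); (x', y)]
| tens_eq_addr x y y' : tens_eq [:: (x, y + y')] [:: (x, y); (x, y')]
| tens_eq_scale c x y : tens_eq [:: (c *: x, y)] [:: (x, c *: y)].

Section Tensor.
Variables (K : comNzRingType) (A B : lmodType K).
Implicit Types l m : seq (A * B).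

Definition tens_eqb l m := `[< tens_eq l m >].

Fact tens_eqb_refl : reflexive tens_eqb.
Proof. by move=> l; apply/asboolP; exact: tens_eq_refl. Qed.
Fact tens_eqb_sym : symmetric tens_eqb.
Proof. by move=> l m; apply/asboolP/asboolP; exact: tens_eq_sym. Qed.
Fact tens_eqb_trans : transitive tens_eqb.
Proof. by move=> l m n /asboolP ml /asboolP ln; apply/asboolP/(tens_eq_trans ml). Qed.

Canonical tens_equiv :=
  EquivRel tens_eqb tens_eqb_refl tens_eqb_sym tens_eqb_trans.

Definition tens := {eq_quot tens_equiv}%qT.

HB.instance Definition _ := EqQuotient.on tens.
HB.instance Definition _ := Choice.on tens.

Definition tens_sum l : tens := (\pi_tens l)%qT.

Lemma tens_sumP l m : tens_sum l = tens_sum m <-> tens_eq l m.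
Proof. by split=> [/eqmodP/asboolP|?] //; apply/eqmodP/asboolP. Qed.

Lemma tens_ind (P : tens -> Prop) :
  (forall l, P (tens_sum l)) -> forall u, P u.
Proof. by move=> Pl u; rewrite -(reprK u). Qed.

Definition tens_add (u v : tens) : tens := tens_sum (repr u ++ repr v).
Definition scale_pair (c : K) (p : A * B) : A * B := (c *: p.1, p.2).
Definition tens_scale (c : K) (u : tens) : tens :=
  tens_sum (map (scale_pair c) (repr u)).
Definition tens_opp (u : tens) : tens := tens_scale (- 1) u.

Lemma tens_eq_repr l : tens_eq (repr (tens_sum l)) l.
Proof. by apply/tens_sumP; rewrite /tens_sum reprK. Qed.

Lemma tens_sum_cat l m : tens_add (tens_sum l) (tens_sum m) = tens_sum (l ++ m).
Proof. by apply/tens_sumP/tens_eq_cat; exact: tens_eq_repr. Qed.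

Lemma tens_eq_map c l m : tens_eq l m ->
  tens_eq (map (scale_pair c) l) (map (scale_pair c) m).
Proof.
elim=> {l m} => [l|l m _|l m n _ lm _|l l' m m' _ ll _ mm|l m|y|x x' y|x y y'|d x y] /=.
- exact: tens_eq_refl.
- exact: tens_eq_sym.
- exact: tens_eq_trans.
- by rewrite !map_cat; exact: tens_eq_cat.
- by rewrite !map_cat; exact: tens_eq_catC.
- by rewrite /scale_pair /= scaler0; exact: tens_eq_0.
- by rewrite /scale_pair /= scalerDr; exact: tens_eq_addl.
- exact: tens_eq_addr.
- rewrite /scale_pair /= scalerA mulrC -scalerA; exact: tens_eq_scale.
Qed.

Lemma tens_sum_scale c l :
  tens_scale c (tens_sum l) = tens_sum (map (scale_pair c) l).
Proof. by apply/tens_sumP/tens_eq_map; exact: tens_eq_repr. Qed.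

Fact tens_addA : associative tens_add.
Proof.
elim/tens_ind=> l; elim/tens_ind=> m; elim/tens_ind=> n.
by rewrite !tens_sum_cat catA.
Qed.
Fact tens_addC : commutative tens_add.
Proof.
elim/tens_ind=> l; elim/tens_ind=> m.
by rewrite !tens_sum_cat; apply/tens_sumP; exact: tens_eq_catC.
Qed.
Fact tens_add0 : left_id (tens_sum [::]) tens_add.
Proof. by elim/tens_ind=> l; rewrite tens_sum_cat. Qed.

Fact tens_scaleDl u : {morph tens_scale^~ u : c d / c + d >-> tens_add c d}.
Proof.
elim/tens_ind: u => l c d; rewrite !tens_sum_scale tens_sum_cat.
apply/tens_sumP; elim: l => [|[x y] l IHl] /=; first exact: tens_eq_refl.
set s := map _ l in IHl *; set t := map _ l in IHl *.
set r := map _ l in IHl *.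
rewrite /scale_pair /= scalerDl -cat1s.
apply: tens_eq_trans (tens_eq_cat (tens_eq_addl _ _ _) IHl) _ => /=.
apply: (tens_eq_cat (tens_eq_refl [:: (c *: x, y)])).
rewrite -(cat1s (d *: x, y) (t ++ r)) -(cat1s (d *: x, y) r) !catA.
by apply: tens_eq_cat (tens_eq_catC _ _) (tens_eq_refl _).
Qed.

Fact tens_scale0 u : tens_scale 0 u = tens_sum [::].
Proof.
elim/tens_ind: u => l; rewrite tens_sum_scale; apply/tens_sumP.
elim: l => [|[x y] l IHl] /=; first exact: tens_eq_refl.
rewrite /scale_pair /= scale0r -cat1s -(cat0s [::]).
by apply: tens_eq_cat IHl; exact: tens_eq_0.
Qed.

Fact tens_scale1 : left_id 1 tens_scale.
Proof.
elim/tens_ind=> l; rewrite tens_sum_scale -[in RHS](map_id l); congr tens_sum.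
by apply: eq_map => -[x y]; rewrite /scale_pair /= scale1r.
Qed.

Fact tens_addN : left_inverse (tens_sum [::]) tens_opp tens_add.
Proof.
by move=> u; rewrite -[u in tens_add _ u]tens_scale1 -tens_scaleDl addNr tens_scale0.
Qed.

HB.instance Definition _ := GRing.isZmodule.Build tens
  tens_addA tens_addC tens_add0 tens_addN.

Fact tens_scaleA c d u : tens_scale c (tens_scale d u) = tens_scale (c * d) u.
Proof.
elim/tens_ind: u => l; rewrite !tens_sum_scale -map_comp; congr tens_sum.
by apply: eq_map => -[x y]; rewrite /scale_pair /= scalerA.
Qed.
Fact tens_scaleDr : right_distributive tens_scale +%R.
Proof.
move=> c; elim/tens_ind=> l; elim/tens_ind=> m.
rewrite -[_ + _ in LHS]/(tens_add _ _) tens_sum_cat !tens_sum_scale map_cat.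
by rewrite -tens_sum_cat.
Qed.

HB.instance Definition _ := GRing.Zmodule_isLmodule.Build K tens
  tens_scaleA tens_scale1 tens_scaleDr tens_scaleDl.

Lemma tens_sumD l m : tens_sum l + tens_sum m = tens_sum (l ++ m).
Proof. exact: tens_sum_cat. Qed.

Lemma tens_sumZ c l : c *: tens_sum l = tens_sum (map (scale_pair c) l).
Proof. exact: tens_sum_scale. Qed.

Definition tens_elem (x : A) (y : B) : tens := tens_sum [:: (x, y)].

Lemma tens_sumE l : tens_sum l = \sum_(p <- l) tens_elem p.1 p.2.
Proof.
elim: l => [|[x y] l IHl]; first by rewrite big_nil.
by rewrite big_cons -IHl tens_sumD.
Qed.

Lemma tens_elem_linl y : linear (tens_elem^~ y).
Proof.
move=> c x x'; rewrite /tens_elem tens_sumZ tens_sumD.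
by apply/tens_sumP; exact: tens_eq_addl.
Qed.

Lemma tens_elem_linr x : linear (tens_elem x).
Proof.
move=> c y y'; rewrite /tens_elem tens_sumZ tens_sumD.
apply/tens_sumP; apply: tens_eq_trans (tens_eq_addr _ _ _) _.
rewrite -cat1s -[X in tens_eq _ X]cat1s; apply: tens_eq_cat (tens_eq_refl _).
by apply/tens_eq_sym; exact: tens_eq_scale.
Qed.

Section Lift.
Variables (W : lmodType K) (f : A -> B -> W).
Hypotheses (fl : forall y, linear (f^~ y)) (fr : forall x, linear (f x)).

Definition tens_lift (u : tens) : W := \sum_(p <- repr u) f p.1 p.2.

Lemma tens_lift_sum l : tens_lift (tens_sum l) = \sum_(p <- l) f p.1 p.2.
Proof.
have f0 y : f 0 y = 0.
  by have := fl y (-1) 0 0; rewrite scaler0 addr0 scaleN1r addNr.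
have fD x x' y : f (x + x') y = f x y + f x' y.
  by have := fl y 1 x x'; rewrite !scale1r.
have fD' x y y' : f x (y + y') = f x y + f x y'.
  by have := fr x 1 y y'; rewrite !scale1r.
have f0' x : f x 0 = 0 by have := fD' x 0 0; rewrite addr0 => /eqP; rewrite -subr_eq subrr => /eqP <-.
have fZ c x y : f (c *: x) y = c *: f x y.
  by have := fl y c x 0; rewrite !addr0 f0 addr0.
have fZ' c x y : f x (c *: y) = c *: f x y.
  by have := fr x c y 0; rewrite !addr0 f0' addr0.
rewrite /tens_lift; move: (repr _) (tens_eq_repr l) => k kl.
elim: kl => {k l} //=.
- by move=> l m n _ -> _ ->.
- by move=> l l' m m' _ ll' _ mm'; rewrite !big_cat /= ll' mm'.
- by move=> l m; rewrite !big_cat /= addrC.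
- by move=> y; rewrite big_seq1 big_nil.
- by move=> x x' y; rewrite big_seq1 !big_cons big_nil addr0 fD.
- by move=> x y y'; rewrite big_seq1 !big_cons big_nil addr0 fD'.
- by move=> c x y; rewrite !big_seq1 /= fZ fZ'.
Qed.

Lemma tens_lift_linear : linear tens_lift.
Proof.
move=> c; elim/tens_ind=> l; elim/tens_ind=> m.
rewrite tens_sumZ tens_sumD !tens_lift_sum big_cat big_map /=.
congr (_ + _); rewrite scaler_sumr; apply: eq_bigr => -[x y] _ /=.
have f0 z : f 0 z = 0.
  by have := fl z (-1) 0 0; rewrite scaler0 addr0 scaleN1r addNr.
by have := fl y c x 0; rewrite !addr0 f0 addr0.
Qed.

Lemma tens_lift_elem x y : tens_lift (tens_elem x y) = f x y.
Proof. by rewrite tens_lift_sum big_seq1. Qed.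

End Lift.

End Tensor.

Record seminorm (R : realType) (V : lmodType R[i]) := Seminorm {
  sn_fun :> V -> R;
  sn_triangle : forall x y, sn_fun (x + y) <= sn_fun x + sn_fun y;
  sn_homog : forall (c : R[i]) x,
    sn_fun (c *: x) = nrm (c : R[i]^o) * sn_fun x }.

Section SeminormTheory.
Variables (R : realType) (V : lmodType R[i]) (p : seminorm V).

Lemma sn0 : p 0 = 0.
Proof. by rewrite -(scale0r 0) sn_homog nrm0 mul0r. Qed.

Lemma snN x : p (- x) = p x.
Proof.
rewrite -scaleN1r sn_homog (_ : nrm _ = 1) ?mul1r //.
by apply: (@complexI R); rewrite -nrmE normrN normr1.
Qed.

Lemma sn_ge0 x : 0 <= p x.
Proof.
have := sn_triangle p x (- x); rewrite subrr sn0 snN -mulr2n.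
by rewrite pmulrn_lge0.
Qed.

Lemma sn_distC x y : p (x - y) = p (y - x).
Proof. by rewrite -snN opprB. Qed.

Lemma ler_sn_dist x y : `|p x - p y| <= p (x - y).
Proof.
rewrite ler_norml; apply/andP; split.
  by rewrite lerNl opprB lerBlDr sn_distC -{1}(subrK x y) sn_triangle.
by rewrite lerBlDr -{1}(subrK y x) sn_triangle.
Qed.

Lemma sn_cauchy_cvg (u : nat -> V) :
  cauchy_for p u -> cvg ((fun n => p (u n)) @ \oo).
Proof.
move=> uc; apply: real_cauchy_cvg => e /uc[N HN]; exists N => m n Nm Nn.
exact: le_lt_trans (ler_sn_dist _ _) (HN _ _ Nm Nn).
Qed.

End SeminormTheory.

(* The completion of V for the seminorm p: Cauchy sequences modulo sequences
   that tend to 0, with the norm lim_n p (u n). *)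
Section Completion.
Variables (R : realType) (V : lmodType R[i]) (p : seminorm V).

Record cauchy_seq := CauchySeq {
  cs_fun :> nat -> V;
  cs_cauchy : cauchy_for p cs_fun }.

HB.instance Definition _ := gen_eqMixin cauchy_seq.
HB.instance Definition _ := gen_choiceMixin cauchy_seq.

Definition same_limit (u v : nat -> V) :=
  forall e : R, 0 < e -> exists N, forall n, (N <= n)%N -> p (u n - v n) < e.

Lemma same_limit_refl u : same_limit u u.
Proof. by move=> e e0; exists 0%N => n _; rewrite subrr sn0. Qed.

Lemma same_limit_sym u v : same_limit u v -> same_limit v u.
Proof.
by move=> uv e /uv[N HN]; exists N => n /HN; rewrite sn_distC.
Qed.

Lemma same_limit_add u u' v v' : same_limit u u' -> same_limit v v' ->
  same_limit (fun n => u n + v n) (fun n => u' n + v' n).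
Proof.
move=> uu vv e e0; have e20 : 0 < e / 2 by rewrite divr_gt0.
have [N HN] := uu _ e20; have [M HM] := vv _ e20.
exists (maxn N M) => n; rewrite geq_max => /andP[Nn Mn].
rewrite opprD addrACA [ltRHS]splitr.
by apply: le_lt_trans (sn_triangle _ _ _) _; rewrite ltrD ?HN ?HM.
Qed.

Lemma same_limit_trans u v w :
  same_limit u v -> same_limit v w -> same_limit u w.
Proof.
move=> uv vw e /(same_limit_add uv vw)[N HN]; exists N => n /HN.
by rewrite [v n + w n]addrC opprD addrACA subrr addr0.
Qed.

Definition same_limitb (u v : cauchy_seq) := `[< same_limit u v >].

Fact same_limitb_refl : reflexive same_limitb.
Proof. by move=> u; apply/asboolP; exact: same_limit_refl. Qed.
Fact same_limitb_sym : symmetric same_limitb.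
Proof. by move=> u v; apply/asboolP/asboolP; exact: same_limit_sym. Qed.
Fact same_limitb_trans : transitive same_limitb.
Proof.
by move=> v u w /asboolP uv /asboolP vw; apply/asboolP/(same_limit_trans uv).
Qed.

Canonical same_limit_equiv :=
  EquivRel same_limitb same_limitb_refl same_limitb_sym same_limitb_trans.

Definition completion := {eq_quot same_limit_equiv}%qT.

HB.instance Definition _ := EqQuotient.on completion.
HB.instance Definition _ := Choice.on completion.

Definition compl_lim (u : cauchy_seq) : completion := (\pi_completion u)%qT.

Lemma compl_limP u v : compl_lim u = compl_lim v <-> same_limit u v.
Proof. by split=> [/eqmodP/asboolP|?] //; apply/eqmodP/asboolP. Qed.

Lemma compl_ind (P : completion -> Prop) :
  (forall u, P (compl_lim u)) -> forall x, P x.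
Proof. by move=> Pu x; rewrite -(reprK x). Qed.

Lemma same_limit_repr u : same_limit (repr (compl_lim u)) u.
Proof. by apply/compl_limP; rewrite /compl_lim reprK. Qed.

Fact cst_cauchy v : cauchy_for p (fun _ => v).
Proof. by move=> e e0; exists 0%N => m n _ _; rewrite subrr sn0. Qed.
Definition cs_cst v := CauchySeq (cst_cauchy v).

Fact add_cauchy (u v : cauchy_seq) : cauchy_for p (fun n => u n + v n).
Proof.
move=> e e0; have e20 : 0 < e / 2 by rewrite divr_gt0.
have [N HN] := cs_cauchy u e20; have [M HM] := cs_cauchy v e20.
exists (maxn N M) => m n; rewrite !geq_max => /andP[Nm Mm] /andP[Nn Mn].
rewrite opprD addrACA [ltRHS]splitr.
by apply: le_lt_trans (sn_triangle _ _ _) _; rewrite ltrD ?HN ?HM.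
Qed.
Definition cs_add u v := CauchySeq (add_cauchy u v).

Lemma sn_scale_lt (c : R[i]) (e : R) : 0 < e ->
  exists2 d : R, 0 < d & forall x, p x < d -> p (c *: x) < e.
Proof.
move=> e0; have c1 : 0 < nrm (c : R[i]^o) + 1.
  by rewrite ltr_wpDl ?nrm_ge0.
exists (e / (nrm (c : R[i]^o) + 1)); first by rewrite divr_gt0.
move=> x; rewrite ltr_pdivlMr // sn_homog => xe; apply: le_lt_trans xe.
by rewrite mulrC ler_wpM2l ?sn_ge0 // lerDl.
Qed.

Fact scale_cauchy (c : R[i]) (u : cauchy_seq) : cauchy_for p (fun n => c *: u n).
Proof.
move=> e e0; have [d d0 dP] := sn_scale_lt c e0.
have [N HN] := cs_cauchy u d0; exists N => m n Nm Nn.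
by rewrite -scalerBr; apply: dP; exact: HN.
Qed.
Definition cs_scale c u := CauchySeq (scale_cauchy c u).

Definition compl_add (x y : completion) : completion :=
  compl_lim (cs_add (repr x) (repr y)).
Definition compl_scale (c : R[i]) (x : completion) : completion :=
  compl_lim (cs_scale c (repr x)).
Definition compl_opp (x : completion) : completion := compl_scale (- 1) x.
Definition compl_in (v : V) : completion := compl_lim (cs_cst v).

Lemma compl_add_lim u v :
  compl_add (compl_lim u) (compl_lim v) = compl_lim (cs_add u v).
Proof. by apply/compl_limP/same_limit_add; exact: same_limit_repr. Qed.

Lemma compl_scale_lim c u :
  compl_scale c (compl_lim u) = compl_lim (cs_scale c u).
Proof.
apply/compl_limP => e e0; have [d d0 dP] := sn_scale_lt c e0.
have [N HN] := same_limit_repr u d0; exists N => n Nn /=.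
by rewrite -scalerBr; apply: dP; exact: HN.
Qed.

Lemma compl_lim_eq (u v : cauchy_seq) :
  (forall n, u n = v n) -> compl_lim u = compl_lim v.
Proof.
by move=> /funext uv; apply/compl_limP; rewrite uv; exact: same_limit_refl.
Qed.

Fact compl_addA : associative compl_add.
Proof.
elim/compl_ind=> u; elim/compl_ind=> v; elim/compl_ind=> w.
by rewrite !compl_add_lim; apply: compl_lim_eq => n /=; rewrite addrA.
Qed.
Fact compl_addC : commutative compl_add.
Proof.
elim/compl_ind=> u; elim/compl_ind=> v.
by rewrite !compl_add_lim; apply: compl_lim_eq => n /=; rewrite addrC.
Qed.
Fact compl_add0 : left_id (compl_in 0) compl_add.
Proof.
by elim/compl_ind=> u; rewrite compl_add_lim; apply: compl_lim_eq => n /=; rewrite add0r.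
Qed.
Fact compl_addN : left_inverse (compl_in 0) compl_opp compl_add.
Proof.
elim/compl_ind=> u; rewrite /compl_opp compl_scale_lim compl_add_lim.
by apply: compl_lim_eq => n /=; rewrite scaleN1r addNr.
Qed.

HB.instance Definition _ := GRing.isZmodule.Build completion
  compl_addA compl_addC compl_add0 compl_addN.

Fact compl_scaleA c d x : compl_scale c (compl_scale d x) = compl_scale (c * d) x.
Proof.
elim/compl_ind: x => u; rewrite !compl_scale_lim.
by apply: compl_lim_eq => n /=; rewrite scalerA.
Qed.
Fact compl_scale1 : left_id 1 compl_scale.
Proof.
elim/compl_ind=> u; rewrite compl_scale_lim.
by apply: compl_lim_eq => n /=; rewrite scale1r.
Qed.
Fact compl_scaleDr : right_distributive compl_scale compl_add.
Proof.
move=> c; elim/compl_ind=> u; elim/compl_ind=> v.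
rewrite !(compl_scale_lim, compl_add_lim).
by apply: compl_lim_eq => n /=; rewrite scalerDr.
Qed.
Fact compl_scaleDl x : {morph compl_scale^~ x : c d / c + d >-> compl_add c d}.
Proof.
elim/compl_ind: x => u c d; rewrite !(compl_scale_lim, compl_add_lim).
by apply: compl_lim_eq => n /=; rewrite scalerDl.
Qed.

HB.instance Definition _ := GRing.Zmodule_isLmodule.Build R[i] completion
  compl_scaleA compl_scale1 compl_scaleDr compl_scaleDl.

Lemma compl_limD u v : compl_lim u + compl_lim v = compl_lim (cs_add u v).
Proof. exact: compl_add_lim. Qed.

Lemma compl_limZ c u : c *: compl_lim u = compl_lim (cs_scale c u).
Proof. exact: compl_scale_lim. Qed.

Lemma compl_limB u v :
  compl_lim u - compl_lim v = compl_lim (cs_add u (cs_scale (- 1) v)).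
Proof. by rewrite -scaleN1r compl_limZ compl_limD. Qed.

Definition compl_norm (x : completion) : R := lim ((fun n => p (repr x n)) @ \oo).

Lemma compl_norm_lim (u : cauchy_seq) :
  (fun n => p (u n)) @ \oo --> compl_norm (compl_lim u).
Proof.
have := sn_cauchy_cvg (cs_cauchy (repr (compl_lim u))).
rewrite /compl_norm => /cvgrPdist_lt ul; apply/cvgrPdist_lt => e e0.
have e20 : 0 < e / 2 by rewrite divr_gt0.
have [N _ HN] := ul _ e20; have [M HM] := same_limit_repr u e20.
exists (maxn N M) => // n /=; rewrite geq_max => /andP[Nn Mn].
rewrite -(subrKA (p (repr (compl_lim u) n))) [ltRHS]splitr.
apply: le_lt_trans (ler_normD _ _) _; apply: ltrD; first exact: HN.
exact: le_lt_trans (ler_sn_dist _ _ _) (HM _ Mn).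
Qed.

Arguments compl_norm_lim : clear implicits.

Lemma compl_norm_eq (u : cauchy_seq) (l : R) :
  (fun n => p (u n)) @ \oo --> l -> compl_norm (compl_lim u) = l.
Proof. by move=> ul; exact: (cvg_unique (@Rhausdorff R) (compl_norm_lim u) ul). Qed.

Lemma compl_norm_in v : compl_norm (compl_in v) = p v.
Proof. by apply: (@compl_norm_eq (cs_cst v)) => /=; exact: (cvg_cst (p v)). Qed.

Fact compl_normD x y : (compl_norm (x + y))%:C <= (compl_norm x)%:C + (compl_norm y)%:C.
Proof.
elim/compl_ind: x => u; elim/compl_ind: y => v; rewrite compl_limD -rmorphD lecR.
apply: ler_cvg_to (compl_norm_lim _)
  (cvgD (compl_norm_lim u) (compl_norm_lim v)) _.
by apply: nearW => n /=; exact: sn_triangle.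
Qed.
Fact compl_normZ (c : R[i]) x : (compl_norm (c *: x))%:C = `|c| * (compl_norm x)%:C.
Proof.
elim/compl_ind: x => u; rewrite compl_limZ (nrmE (c : R[i]^o)) -rmorphM.
congr (_%:C); apply: compl_norm_eq.
rewrite (_ : (fun n => _) = (fun n => nrm (c : R[i]^o) * p (u n))).
  by apply: cvgMl_tmp; exact: compl_norm_lim.
by apply: funext => n /=; rewrite sn_homog.
Qed.
Fact compl_norm0_eq0 x : (compl_norm x)%:C = 0 -> x = 0.
Proof.
elim/compl_ind: x => u /(@complexI R) u0; apply/compl_limP => e e0 /=.
have := compl_norm_lim u; rewrite u0 => /cvgrPdist_lt/(_ _ e0)[N _ HN].
exists N => n /HN /=; rewrite subr0 sub0r normrN.
by apply: le_lt_trans; exact: ler_norm.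
Qed.

HB.instance Definition _ := Lmodule_isNormed.Build R[i] completion
  compl_normD compl_normZ compl_norm0_eq0.

Lemma nrm_completion (x : completion) : nrm x = compl_norm x.
Proof. by []. Qed.

Lemma compl_in_linear : linear compl_in.
Proof.
move=> c x y; rewrite /compl_in compl_limZ compl_limD.
exact: compl_lim_eq.
Qed.

Lemma compl_in_dense (x : completion) (e : R) : 0 < e ->
  exists v, nrm (x - compl_in v) < e.
Proof.
elim/compl_ind: x => u e0; have e20 : 0 < e / 2 by rewrite divr_gt0.
have [N HN] := cs_cauchy u e20; exists (u N).
rewrite nrm_completion compl_limB.
apply: (@le_lt_trans _ _ (e / 2)); last by rewrite ltr_pdivrMr // ltr_pMr // ltr1n.
apply: ler_cvg_to (compl_norm_lim _) (cvg_cst (e / 2)) _.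
by exists N => // n /= Nn; rewrite scaleN1r ltW // HN.
Qed.

Fact compl_complete (F : set_system completion) :
  ProperFilter F -> cauchy F -> cvg F.
Proof.
apply: cauchy_seq_complete => x xc.
have /choice[v xv] : forall n, exists v, nrm (x n - compl_in v) < harm R n.
  by move=> n; apply: compl_in_dense; exact: harm_gt0.
have vE m n : p (v m - v n) = nrm (compl_in (v m) - compl_in (v n)).
  rewrite nrm_completion -compl_norm_in; congr compl_norm.
  by rewrite -scaleN1r addrC compl_in_linear scaleN1r addrC.
have vc : cauchy_for p v.
  move=> e e0; have e30 : 0 < e / 3 by rewrite divr_gt0.
  have [N HN] := xc _ e30; have [M HM] := harm_small e30.
  exists (maxn N M) => m n; rewrite !geq_max => /andP[Nm Mm] /andP[Nn Mn].
  rewrite vE -(subrKA (x m)) -[x m - _](subrKA (x n)).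
  apply: le_lt_trans (ler_nrmD _ _) _.
  rewrite (_ : e = e / 3 + (e / 3 + e / 3)); last first.
    by rewrite -!mulrDl -!mulr2n -mulrS -[e *+ 3]mulr_natr mulfK ?pnatr_eq0.
  apply: ltrD; first by rewrite nrm_distC; apply: lt_trans (xv m) (HM _ Mm).
  apply: le_lt_trans (ler_nrmD _ _) _; apply: ltrD; first exact: HN.
  exact: lt_trans (xv n) (HM _ Mn).
pose l := compl_lim (CauchySeq vc); exists l => e e0.
have e20 : 0 < e / 2 by rewrite divr_gt0.
have e40 : 0 < e / 2 / 2 by rewrite divr_gt0.
have [N HN] := vc _ e40; have [M HM] := harm_small e20.
exists (maxn N M) => n; rewrite !geq_max => /andP[Nn Mn].
rewrite -(subrKA (compl_in (v n))) [ltRHS]splitr.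
apply: le_lt_trans (ler_nrmD _ _) _.
apply: ltrD; first exact: lt_trans (xv n) (HM _ Mn).
rewrite nrm_distC nrm_completion compl_limB.
apply: (@le_lt_trans _ _ (e / 2 / 2)).
  apply: ler_cvg_to (compl_norm_lim _) (cvg_cst (e / 2 / 2)) _.
  by exists N => // k /= Nk; rewrite scaleN1r ltW // HN.
by rewrite ltr_pdivrMr // ltr_pMr // ltr1n.
Qed.

HB.instance Definition _ := Uniform_isComplete.Build completion compl_complete.

End Completion.

Arguments compl_norm_lim {R V p} u.

Section Extension.
Variables (R : realType) (V : lmodType R[i]) (p : seminorm V).
Variables (W : completeNormedModType R[i]) (T : V -> W).
Hypothesis T_linear : linear T.
Hypothesis T_bounded : exists M : R, forall v, nrm (T v) <= M * p v.

Let T_pos : exists2 M : R, 0 < M & forall v, nrm (T v) <= M * p v.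
Proof.
have [M TM] := T_bounded; exists (`|M| + 1); first by rewrite ltr_wpDl.
move=> v; apply: le_trans (TM v) _; rewrite ler_wpM2r ?sn_ge0 //.
by apply: le_trans (ler_norm _) _; rewrite lerDl.
Qed.

Let TB x y : T (x - y) = T x - T y.
Proof. by rewrite -scaleN1r addrC T_linear scaleN1r addrC. Qed.

Lemma extension_cvg (u : cauchy_seq p) : cvg ((fun n => T (u n)) @ \oo).
Proof.
apply: cauchy_for_cvg => e e0; have [M M0 TM] := T_pos.
have eM : 0 < e / M by rewrite divr_gt0.
have [N HN] := cs_cauchy u eM; exists N => m n Nm Nn.
rewrite -TB; apply: le_lt_trans (TM _) _.
by rewrite mulrC -ltr_pdivlMr // HN.
Qed.

Arguments extension_cvg : clear implicits.

Definition extension (x : completion p) : W :=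
  lim ((fun n => T (repr x n)) @ \oo).

Lemma extension_lim (u : cauchy_seq p) :
  (fun n => T (u n)) @ \oo --> extension (compl_lim u).
Proof.
have /cvg_forP ul := extension_cvg (repr (compl_lim u)).
apply/cvg_forP => e e0; have [M M0 TM] := T_pos.
have e20 : 0 < e / 2 by rewrite divr_gt0.
have eM : 0 < e / 2 / M by rewrite divr_gt0.
have [N HN] := ul _ e20; have [N' HN'] := same_limit_repr u eM.
exists (maxn N N') => n; rewrite geq_max => /andP[Nn Nn'].
rewrite -(subrKA (T (repr (compl_lim u) n))) [ltRHS]splitr.
apply: le_lt_trans (ler_nrmD _ _) _; apply: ltrD; last exact: HN.
rewrite nrm_distC -TB; apply: le_lt_trans (TM _) _.
by rewrite mulrC -ltr_pdivlMr // HN'.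
Qed.
Arguments extension_lim : clear implicits.

Lemma extension_eq (u : cauchy_seq p) (l : W) :
  (fun n => T (u n)) @ \oo --> l -> extension (compl_lim u) = l.
Proof.
by move=> ul; exact: (cvg_unique (@norm_hausdorff _ _) (extension_lim u) ul).
Qed.

Lemma extension_in v : extension (compl_in p v) = T v.
Proof.
by apply: (@extension_eq (cs_cst p v)) => /=; exact: (cvg_cst (T v)).
Qed.

Lemma extension_linear : linear extension.
Proof.
move=> c; elim/compl_ind=> u; elim/compl_ind=> v.
rewrite compl_limZ compl_limD; apply: extension_eq => /=.
rewrite (_ : (fun n => _) = (fun n => c *: T (u n) + T (v n))); last first.
  by apply: funext => n; rewrite T_linear.
by apply: cvgD (extension_lim v); apply: cvgZr; exact: extension_lim.
Qed.

Lemma extension_bound (M : R) : (forall v, nrm (T v) <= M * p v) ->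
  forall x, nrm (extension x) <= M * nrm x.
Proof.
move=> TM; elim/compl_ind=> u; rewrite nrm_completion.
apply: ler_cvg_to (cvg_nrm (extension_lim u))
  (cvgMl_tmp (compl_norm_lim u)) _.
by apply: nearW => n.
Qed.

Lemma extension_bounded : exists M : R, forall x, nrm (extension x) <= M * nrm x.
Proof. by have [M TM] := T_bounded; exists M; exact: extension_bound. Qed.

Definition extension_blin : blin (completion p) W :=
  Blin extension_linear extension_bounded.

End Extension.

Section ProjectiveNorm.
Variables (R : realType) (A B : normedModType R[i]).
Implicit Types (l m : seq (A * B)) (u v : tens A B).

Definition proj_cost l : R := \sum_(q <- l) nrm q.1 * nrm q.2.

Definition proj_norm (u : tens A B) : R :=
  inf [set proj_cost l | l in [set l | tens_sum l = u]].

Lemma proj_cost_ge0 l : 0 <= proj_cost l.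
Proof. by apply: sumr_ge0 => q _; rewrite mulr_ge0 ?nrm_ge0. Qed.

Lemma proj_norm_has_inf u :
  has_inf [set proj_cost l | l in [set l | tens_sum l = u]].
Proof.
split; last by exists 0 => _ [l _ <-]; exact: proj_cost_ge0.
elim/tens_ind: u => l.
by exists (proj_cost l); exists l.
Qed.

Lemma proj_norm_le l : proj_norm (tens_sum l) <= proj_cost l.
Proof. by apply: ge_inf; [case: (proj_norm_has_inf (tens_sum l))|exists l]. Qed.

Lemma proj_norm_lt u (e : R) : 0 < e ->
  exists2 l, tens_sum l = u & proj_cost l < proj_norm u + e.
Proof.
move=> e0; have [_ [l lu <-] le] := inf_adherent e0 (proj_norm_has_inf u).
by exists l.
Qed.

Fact proj_norm_triangle u v : proj_norm (u + v) <= proj_norm u + proj_norm v.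
Proof.
apply/ler_addgt0Pr => e e0; have e20 : 0 < e / 2 by rewrite divr_gt0.
have [l <- le] := proj_norm_lt u e20; have [m <- me] := proj_norm_lt v e20.
rewrite tens_sumD; apply: le_trans (proj_norm_le _) _.
rewrite /proj_cost big_cat /= [e]splitr addrACA.
by apply/ltW/ltrD.
Qed.

Lemma proj_normZ_le (c : R[i]) u : proj_norm (c *: u) <= nrm (c : R[i]^o) * proj_norm u.
Proof.
apply/ler_addgt0Pr => e e0.
have c1 : 0 < nrm (c : R[i]^o) + 1 by rewrite ltr_wpDl ?nrm_ge0.
have ec : 0 < e / (nrm (c : R[i]^o) + 1) by rewrite divr_gt0.
have [l lu le] := proj_norm_lt u ec; rewrite -{1}lu tens_sumZ.
apply: le_trans (proj_norm_le _) _; rewrite /proj_cost big_map.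
rewrite (eq_bigr (fun q => nrm (c : R[i]^o) * (nrm q.1 * nrm q.2))); last first.
  by move=> q _; rewrite /= nrmZ mulrA.
rewrite -mulr_sumr; apply: le_trans (ler_wpM2l (nrm_ge0 _) (ltW le)) _.
rewrite mulrDr lerD2l mulrA ler_pdivrMr // [e * _]mulrC.
by rewrite ler_pM2r // lerDl.
Qed.

Fact proj_norm_homog (c : R[i]) u :
  proj_norm (c *: u) = nrm (c : R[i]^o) * proj_norm u.
Proof.
apply: le_anti; rewrite proj_normZ_le /=.
have [->|c0] := eqVneq c 0.
  rewrite nrm0 mul0r; apply: lb_le_inf; first by case: (proj_norm_has_inf (0 *: u)).
  by move=> _ [l _ <-]; exact: proj_cost_ge0.
have nc : 0 < nrm (c : R[i]^o).
  by rewrite lt_def nrm_ge0 andbT; apply: contra_neq c0 => /nrm0_eq0.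
rewrite -ler_pdivlMl //.
have {1}-> : u = c^-1 *: (c *: u) by rewrite scalerA mulVf // scale1r.
apply: le_trans (proj_normZ_le _ _) _; rewrite ler_wpM2r //; last first.
  by rewrite -lecR -nrmE normfV (nrmE (c : R[i]^o)) fmorphV.
apply: lb_le_inf; first by case: (proj_norm_has_inf (c *: u)).
by move=> _ [l _ <-]; exact: proj_cost_ge0.
Qed.

Definition proj_seminorm : seminorm (tens A B) :=
  Seminorm proj_norm_triangle proj_norm_homog.

End ProjectiveNorm.

Section ProjectiveTensor.
Variable R : realType.

(* The projective tensor product: the completion of the algebraic tensor
   product for the projective norm. *)
Definition ptensor (A B : normedModType R[i]) : completeNormedModType R[i] :=
  completion (proj_seminorm A B).

Definition ptens (A B : normedModType R[i]) (x : A) (y : B) : ptensor A B :=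
  compl_in (proj_seminorm A B) (tens_elem x y).

Record bbilin (A B W : normedModType R[i]) := BBilin {
  bbilin_fun :> A -> B -> W;
  bbilin_linl : forall y, linear (bbilin_fun^~ y);
  bbilin_linr : forall x, linear (bbilin_fun x);
  bbilin_bounded :
    exists2 M : R, 0 <= M & forall x y, nrm (bbilin_fun x y) <= M * (nrm x * nrm y) }.

Section PtensLift.
Variables (A B : normedModType R[i]) (W : completeNormedModType R[i]).
Variable f : bbilin A B W.

Lemma tens_lift_bound (M : R) : 0 <= M ->
  (forall x y, nrm (f x y) <= M * (nrm x * nrm y)) ->
  forall u, nrm (tens_lift f u) <= M * proj_seminorm A B u.
Proof.
move=> M0 fM u; have M1 : 0 < M + 1 by rewrite ltr_wpDl.
apply/ler_addgt0Pr => e e0; have eM : 0 < e / (M + 1) by rewrite divr_gt0.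
have [l <- le] := proj_norm_lt u eM.
rewrite tens_lift_sum; [|exact: bbilin_linl|exact: bbilin_linr].
apply: (@le_trans _ _ (M * proj_cost l)).
  rewrite /proj_cost; elim: l {le} => [|q l IHl].
    by rewrite !big_nil nrm0 mulr0.
  by rewrite !big_cons mulrDr; apply: le_trans (ler_nrmD _ _) _; rewrite lerD.
apply: le_trans (ler_wpM2l M0 (ltW le)) _.
rewrite mulrDr lerD2l mulrA ler_pdivrMr // [e * _]mulrC.
by rewrite ler_pM2r // lerDl.
Qed.

Fact tens_lift_bbilin_linear : linear (tens_lift f).
Proof. by apply: tens_lift_linear; [exact: bbilin_linl|exact: bbilin_linr]. Qed.
Fact tens_lift_bbilin_bounded : exists M : R, forall u,
  nrm (tens_lift f u) <= M * proj_seminorm A B u.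
Proof.
by have [M M0 fM] := bbilin_bounded f; exists M; exact: tens_lift_bound.
Qed.

(* The bounded linear map determined by ptens x y |-> f x y. *)
Definition ptens_lift : blin (ptensor A B) W :=
  extension_blin tens_lift_bbilin_linear tens_lift_bbilin_bounded.

Lemma ptens_liftE x y : ptens_lift (ptens x y) = f x y.
Proof.
rewrite /= extension_in; [|exact: tens_lift_bbilin_linear|exact: tens_lift_bbilin_bounded].
by rewrite tens_lift_elem; [|exact: bbilin_linl|exact: bbilin_linr].
Qed.

End PtensLift.

Section Ptens.
Variables A B : normedModType R[i].

Lemma ptens_linl (y : B) : linear ((@ptens A B)^~ y).
Proof. by move=> c x x'; rewrite /ptens tens_elem_linl compl_in_linear. Qed.

Lemma ptens_linr (x : A) : linear (@ptens A B x).
Proof. by move=> c y y'; rewrite /ptens tens_elem_linr compl_in_linear. Qed.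

Lemma nrm_ptens_le (x : A) (y : B) : nrm (ptens x y) <= nrm x * nrm y.
Proof.
rewrite nrm_completion compl_norm_in /=; apply: le_trans (proj_norm_le _) _.
by rewrite /proj_cost big_seq1.
Qed.

End Ptens.

End ProjectiveTensor.

HB.mixin Record CompleteNormedModule_isBanachAlgebra (R : realType) A
    & CompleteNormedModule R[i] A := {
  bmul : A -> A -> A;
  bmulA : associative bmul;
  bmul_linl : forall b : A, linear (bmul^~ b);
  bmul_linr : forall a : A, linear (bmul a);
  normr_bmul : forall a b : A, `|bmul a b| <= `|a| * `|b| }.

(* Complex Banach algebras, not necessarily unital. *)
#[short(type="banachAlgType")]
HB.structure Definition BanachAlgebra (R : realType) :=
  {A of CompleteNormedModule R[i] A & CompleteNormedModule_isBanachAlgebra R A}.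

Section Amenability.
Variables (R : realType) (A : banachAlgType R).

Lemma nrm_bmul (a b : A) : nrm (bmul a b) <= nrm a * nrm b.
Proof. by rewrite -lecR rmorphM /= -!nrmE normr_bmul. Qed.

Fact bmul_blinl_bounded (a : A) : exists M : R, forall x, nrm (bmul a x) <= M * nrm x.
Proof. by exists (nrm a) => x; exact: nrm_bmul. Qed.
Definition lmul (a : A) : blin A A := Blin (bmul_linr a) (bmul_blinl_bounded a).

Fact bmul_blinr_bounded (a : A) :
  exists M : R, forall x, nrm (bmul x a) <= M * nrm x.
Proof. by exists (nrm a) => x; rewrite mulrC nrm_bmul. Qed.
Definition rmul (a : A) : blin A A := Blin (bmul_linl a) (bmul_blinr_bounded a).

Fact bmul_bbilin_bounded :
  exists2 M : R, 0 <= M & forall x y : A, nrm (bmul x y) <= M * (nrm x * nrm y).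
Proof. by exists 1 => // x y; rewrite mul1r nrm_bmul. Qed.
Definition bmul_bbilin : bbilin A A A :=
  BBilin (@bmul_linl R A) (@bmul_linr R A) bmul_bbilin_bounded.

(* ptens x y |-> x y *)
Definition prod_map : blin (ptensor A A) A := ptens_lift bmul_bbilin.

Section Actions.
Variable a : A.

Let lact_fun (x y : A) : ptensor A A := ptens (bmul a x) y.
Fact lact_linl y : linear (lact_fun^~ y).
Proof. by move=> c x x'; rewrite /lact_fun bmul_linr ptens_linl. Qed.
Fact lact_linr x : linear (lact_fun x).
Proof. exact: ptens_linr. Qed.
Fact lact_bounded :
  exists2 M : R, 0 <= M & forall x y, nrm (lact_fun x y) <= M * (nrm x * nrm y).
Proof.
exists (nrm a); first exact: nrm_ge0.
move=> x y; apply: le_trans (nrm_ptens_le _ _) _.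
by rewrite mulrA ler_wpM2r ?nrm_ge0 ?nrm_bmul.
Qed.

(* ptens x y |-> ptens (a x) y *)
Definition lact : blin (ptensor A A) (ptensor A A) :=
  ptens_lift (BBilin lact_linl lact_linr lact_bounded).

Let ract_fun (x y : A) : ptensor A A := ptens x (bmul y a).
Fact ract_linl y : linear (ract_fun^~ y).
Proof. exact: ptens_linl. Qed.
Fact ract_linr x : linear (ract_fun x).
Proof. by move=> c y y'; rewrite /ract_fun bmul_linl ptens_linr. Qed.
Fact ract_bounded :
  exists2 M : R, 0 <= M & forall x y, nrm (ract_fun x y) <= M * (nrm x * nrm y).
Proof.
exists (nrm a); first exact: nrm_ge0.
move=> x y; apply: le_trans (nrm_ptens_le _ _) _.
by rewrite mulrCA ler_wpM2l ?nrm_ge0 // mulrC nrm_bmul.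
Qed.

(* ptens x y |-> ptens x (y a) *)
Definition ract : blin (ptensor A A) (ptensor A A) :=
  ptens_lift (BBilin ract_linl ract_linr ract_bounded).

End Actions.

(* The canonical extension to a bidual of the module action of a is the
   second adjoint of the action of a. *)
Definition virtual_diagonal (M : bidual (ptensor A A)) : Prop :=
  (forall a : A, biadjoint (lact a) M = biadjoint (ract a) M) /\
  (forall a : A,
     biadjoint (lmul a) (biadjoint prod_map M) = evaluation a /\
     evaluation a = biadjoint (rmul a) (biadjoint prod_map M)).

Definition amenable : Prop := exists M, virtual_diagonal M.

(* The infimum of the empty set is +oo, so that AM = +oo when A is not
   amenable. *)
Definition AM : \bar R :=
  ereal_inf [set (nrm M)%:E | M in [set M | virtual_diagonal M]].

End Amenability.

Arguments amenable {R} A.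
Arguments AM {R} A.

Section Functions.
Variables (R : realType) (I : Type).
Implicit Types x : I -> R[i]^o.

Definition finite_supp x := finite_set [set i | x i != 0].

Definition linf x := exists M : R, forall i, nrm (x i) <= M.

Definition linf_norm x : R := sup [set nrm (x i) | i in setT].

Lemma nrm_le_linf_norm x i : linf x -> nrm (x i) <= linf_norm x.
Proof.
move=> [M xM]; apply: ub_le_sup; last by exists i.
by exists M => _ [j _ <-].
Qed.

Lemma linf_norm_le x (M : R) : 0 <= M -> (forall i, nrm (x i) <= M) ->
  linf_norm x <= M.
Proof.
move=> M0 xM; rewrite /linf_norm; have [[j _]|I0] := pselect (exists i : I, True).
  apply: ge_sup; first by exists (nrm (x j)); exists j.
  by move=> _ [i _ <-].
rewrite (_ : [set _ | _ in _] = set0) ?sup0 //.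
by rewrite -subset0 => r [i _ _]; apply: I0; exists i.
Qed.

End Functions.

(* A Banach space of functions on I is a Banach space together with an
   injective linear map bsl_fun into the functions on I. *)
Record banachSeqLattice (R : realType) (I : Type) := BanachSeqLattice {
  bsl_space :> completeNormedModType R[i];
  bsl_fun : bsl_space -> I -> R[i]^o;
  bsl_linear : linear bsl_fun;
  bsl_inj : injective bsl_fun;
  bsl_c00 : forall x : I -> R[i]^o, finite_supp x -> exists e, bsl_fun e = x;
  bsl_linf : forall e, linf (bsl_fun e);
  bsl_dense : dense [set e | finite_supp (bsl_fun e)];
  bsl_solid : forall (y : bsl_space) (x : I -> R[i]^o), linf x ->
    (forall i, `|x i| <= `|bsl_fun y i|) ->
    exists2 e, bsl_fun e = x & `|e| <= `|y|;
  bsl_sup : forall e, linf_norm (bsl_fun e) <= nrm e }.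

Section LatticeTheory.
Variables (R : realType) (I : Type) (E : banachSeqLattice R I).

(* The constant C_E, the supremum of the norms of the characteristic
   functions of the finite subsets of I. *)
Definition bsl_const : \bar R :=
  ereal_sup [set (nrm e)%:E | e in
    [set e : E | exists2 F : set I, finite_set F & bsl_fun e = \1_F]].

Lemma bsl_funD (e f : E) i : bsl_fun (e + f) i = bsl_fun e i + bsl_fun f i.
Proof. by have := congr1 (@^~ i) (bsl_linear 1 e f); rewrite !scale1r. Qed.

Lemma bsl_fun0 i : bsl_fun (0 : E) i = 0.
Proof. by apply: (addrI (bsl_fun (0 : E) i)); rewrite -bsl_funD !addr0. Qed.

Lemma bsl_funZ (c : R[i]) (e : E) i : bsl_fun (c *: e) i = c * bsl_fun e i.
Proof.
have := congr1 (@^~ i) (bsl_linear c e 0); rewrite addr0 => -> /=.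
by rewrite -[RHS]addr0 -(bsl_fun0 i).
Qed.

Lemma bsl_funB (e f : E) i : bsl_fun (e - f) i = bsl_fun e i - bsl_fun f i.
Proof. by rewrite bsl_funD -scaleN1r bsl_funZ mulN1r. Qed.

Lemma nrm_bsl_fun (e : E) i : nrm (bsl_fun e i) <= nrm e.
Proof. exact: le_trans (nrm_le_linf_norm i (bsl_linf e)) (bsl_sup e). Qed.

Lemma bsl_dominated (y : E) (x : I -> R[i]^o) :
  (forall i, `|x i| <= `|bsl_fun y i|) ->
  exists2 e : E, bsl_fun e = x & `|e| <= `|y|.
Proof.
move=> xy; apply: bsl_solid (xy); have [M yM] := bsl_linf y.
exists M => i; apply: le_trans (yM i).
by rewrite -lecR -!nrmE.
Qed.

Lemma bsl_norm_le (e f : E) :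
  (forall i, `|bsl_fun e i| <= `|bsl_fun f i|) -> `|e| <= `|f|.
Proof. by move=> /bsl_dominated[g /bsl_inj ->]. Qed.

Lemma bsl_cvg_fun (u : nat -> E) l i : cvg_for (@nrm R E) u l ->
  cvg_for (@nrm R R[i]^o) (fun n => bsl_fun (u n) i) (bsl_fun l i).
Proof.
move=> ul e /ul[N HN]; exists N => n /HN; apply: le_lt_trans.
by rewrite -bsl_funB nrm_bsl_fun.
Qed.

End LatticeTheory.

Section ESum.
Variables (R : realType) (I : Type) (E : banachSeqLattice R I).
Variable A : I -> completeNormedModType R[i].

Definition in_esum (a : forall i, A i) : Prop :=
  exists e : E, bsl_fun e = fun i => `|a i|.

Record esum := ESum {
  es_fun :> forall i, A i;
  es_in : in_esum es_fun }.

HB.instance Definition _ := gen_eqMixin esum.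
HB.instance Definition _ := gen_choiceMixin esum.

Implicit Types a b : esum.

Lemma esum_ext a b : (forall i, a i = b i) -> a = b.
Proof.
case: a b => [a ha] [b hb] /= ab.
have {}ab : a = b by apply: functional_extensionality_dep.
by subst b; rewrite (Prop_irrelevance ha hb).
Qed.

(* The element of E whose values are the norms of the coordinates of a. *)
Definition es_env a : E := sval (cid (es_in a)).

Lemma es_envE a i : bsl_fun (es_env a) i = `|a i|.
Proof. by rewrite /es_env; case: cid => e /= ->. Qed.

Lemma in_esum_dominated (a : forall i, A i) (e : E) :
  (forall i, `|a i| <= `|bsl_fun e i|) -> in_esum a.
Proof.
move=> ae; have [i|f fa _] := @bsl_dominated R I E e (fun i => `|a i|).
  by rewrite normr_id.
by exists f.
Qed.

Fact es0_in : in_esum (fun i => 0 : A i).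
Proof. by apply: (@in_esum_dominated _ 0) => i; rewrite normr0 normr_ge0. Qed.
Definition es0 := ESum es0_in.

Fact es_add_in a b : in_esum (fun i => a i + b i).
Proof.
apply: (@in_esum_dominated _ (es_env a + es_env b)) => i.
by rewrite bsl_funD !es_envE ger0_norm ?addr_ge0 ?ler_normD.
Qed.
Definition es_add a b := ESum (es_add_in a b).

Fact es_opp_in a : in_esum (fun i => - a i).
Proof.
by apply: (@in_esum_dominated _ (es_env a)) => i; rewrite es_envE normr_id normrN.
Qed.
Definition es_opp a := ESum (es_opp_in a).

Fact es_scale_in (c : R[i]) a : in_esum (fun i => c *: a i).
Proof.
apply: (@in_esum_dominated _ (c *: es_env a)) => i.
by rewrite bsl_funZ es_envE normrM normr_id normrZ.
Qed.
Definition es_scale c a := ESum (es_scale_in c a).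

Fact es_addA : associative es_add.
Proof. by move=> a b c; apply: esum_ext => i /=; rewrite addrA. Qed.
Fact es_addC : commutative es_add.
Proof. by move=> a b; apply: esum_ext => i /=; rewrite addrC. Qed.
Fact es_add0 : left_id es0 es_add.
Proof. by move=> a; apply: esum_ext => i /=; rewrite add0r. Qed.
Fact es_addN : left_inverse es0 es_opp es_add.
Proof. by move=> a; apply: esum_ext => i /=; rewrite addNr. Qed.

HB.instance Definition _ := GRing.isZmodule.Build esum
  es_addA es_addC es_add0 es_addN.

Fact es_scaleA c d a : es_scale c (es_scale d a) = es_scale (c * d) a.
Proof. by apply: esum_ext => i /=; rewrite scalerA. Qed.
Fact es_scale1 : left_id 1 es_scale.
Proof. by move=> a; apply: esum_ext => i /=; rewrite scale1r. Qed.
Fact es_scaleDr : right_distributive es_scale +%R.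
Proof. by move=> c a b; apply: esum_ext => i /=; rewrite scalerDr. Qed.
Fact es_scaleDl a : {morph es_scale^~ a : c d / c + d}.
Proof. by move=> c d; apply: esum_ext => i /=; rewrite scalerDl. Qed.

HB.instance Definition _ := GRing.Zmodule_isLmodule.Build R[i] esum
  es_scaleA es_scale1 es_scaleDr es_scaleDl.

Definition es_norm a : R[i] := `|es_env a|.

Fact es_normD a b : es_norm (a + b) <= es_norm a + es_norm b.
Proof.
apply: le_trans (ler_normD _ _); apply: bsl_norm_le => i.
rewrite bsl_funD !es_envE normr_id ger0_norm ?addr_ge0 //.
exact: ler_normD.
Qed.
Fact es_normZ (c : R[i]) a : es_norm (c *: a) = `|c| * es_norm a.
Proof.
rewrite /es_norm -normrZ; apply: le_anti.
by apply/andP; split; apply: bsl_norm_le => i;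
  rewrite bsl_funZ !es_envE normrM !normr_id normrZ.
Qed.
Fact es_norm0_eq0 a : es_norm a = 0 -> a = 0.
Proof.
move=> /normr0_eq0 a0; apply: esum_ext => i /=; apply/normr0_eq0.
by rewrite -es_envE a0 bsl_fun0.
Qed.

HB.instance Definition _ := Lmodule_isNormed.Build R[i] esum
  es_normD es_normZ es_norm0_eq0.

Lemma nrm_esum a : nrm a = nrm (es_env a).
Proof. by []. Qed.

Lemma esumB a b i : (a - b) i = a i - b i.
Proof. by []. Qed.

Lemma nrm_es_fun a i : nrm (a i) <= nrm a.
Proof.
rewrite nrm_esum; apply: le_trans (nrm_bsl_fun _ i).
by rewrite -lecR -!nrmE es_envE normr_id.
Qed.

Lemma es_env_dist a b : nrm (es_env a - es_env b) <= nrm (a - b).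
Proof.
rewrite nrm_esum -lecR -!nrmE; apply: bsl_norm_le => i.
by rewrite bsl_funB !es_envE normr_id ler_dist_dist.
Qed.

Lemma es_env_cvg (u : nat -> esum) (l : forall i, A i) :
  cauchy_for (@nrm R esum) u ->
  (forall i, cvg_for (@nrm R (A i)) (fun n => u n i) (l i)) ->
  exists2 e : E, (forall i, bsl_fun e i = `|l i|)
    & cvg_for (@nrm R E) (fun n => es_env (u n)) e.
Proof.
move=> uc ul.
have : cvg ((fun n => es_env (u n)) @ \oo).
  apply: cauchy_for_cvg => d /uc[N HN]; exists N => m n Nm Nn.
  by apply: le_lt_trans (es_env_dist _ _) _; exact: HN.
move=> /cvg_ex[e /cvg_forP ue]; exists e => // i.
have ei : cvg_for (@nrm R R[i]^o) (fun n => bsl_fun (es_env (u n)) i) (bsl_fun e i).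
  exact: bsl_cvg_fun.
apply: (@cvg_for_uniq _ _ _ _ (`|l i| : R[i]^o) ei) => d d0.
have [N HN] := ul i d d0.
exists N => n Nn; apply: le_lt_trans (HN n Nn).
rewrite -lecR -!nrmE es_envE; exact: ler_dist_dist.
Qed.

Fact esum_complete (F : set_system esum) :
  ProperFilter F -> cauchy F -> cvg F.
Proof.
apply: cauchy_seq_complete => u uc.
have ex_l : forall i, exists l : A i,
    cvg_for (@nrm R (A i)) (fun n => u n i) l.
  move=> i; have : cvg ((fun n => u n i) @ \oo).
    apply: cauchy_for_cvg => d /uc[N HN]; exists N => m n Nm Nn.
    by apply: le_lt_trans (HN m n Nm Nn); rewrite -esumB nrm_es_fun.
  by move=> /cvg_ex[l /cvg_forP ?]; exists l.
pose l i := sval (cid (ex_l i)).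
have ul i : cvg_for (@nrm R (A i)) (fun n => u n i) (l i).
  by rewrite /l; case: cid.
have [e el _] := es_env_cvg uc ul.
have l_in : in_esum l by exists e; apply: funext.
exists (ESum l_in) => d d0; have d20 : 0 < d / 2 by rewrite divr_gt0.
have [N HN] := uc _ d20; exists N => n Nn.
apply: (@le_lt_trans _ _ (d / 2)); last by rewrite ltr_pdivrMr // ltr_pMr // ltr1n.
have vc : cauchy_for (@nrm R esum) (fun m => u m - u n).
  move=> c /uc[M HM]; exists M => m k Mm Mk.
  by rewrite opprB addrA subrK; exact: HM.
have [|f fl vf] := es_env_cvg (l := fun i => l i - u n i) vc.
  move=> i c c0; have [M HM] := ul i c c0; exists M => m /HM.
  by rewrite esumB opprB addrA subrK.
have -> : nrm (u n - ESum l_in) = nrm f.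
  rewrite nrm_distC nrm_esum; congr nrm; apply: bsl_inj; apply: funext => i.
  by rewrite es_envE fl.
have /cvg_forP/cvg_nrm vf' := vf.
apply: ler_cvg_to vf' (cvg_cst (d / 2)) _.
by exists N => // m /= Nm; apply/ltW/HN.
Qed.

HB.instance Definition _ := Uniform_isComplete.Build esum esum_complete.

End ESum.

Section ESumAlgebra.
Variables (R : realType) (I : Type) (E : banachSeqLattice R I).
Variable A : I -> banachAlgType R.

Local Notation EA := (esum E (fun i => A i)).

Fact es_mul_in (a b : EA) : in_esum E (fun i => bmul (a i) (b i)).
Proof.
apply: (@in_esum_dominated _ _ _ _ _ (`|b| *: es_env a)) => i.
rewrite bsl_funZ es_envE normrM !normr_id mulrC.
apply: le_trans (normr_bmul _ _) _; apply: ler_wpM2l => //.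
by rewrite !nrmE lecR nrm_es_fun.
Qed.
Definition es_mul (a b : EA) : EA := ESum (es_mul_in a b).

Fact es_mulA : associative es_mul.
Proof. by move=> a b c; apply: esum_ext => i /=; rewrite bmulA. Qed.
Fact es_mul_linl (b : EA) : linear (es_mul^~ b).
Proof. by move=> c a a'; apply: esum_ext => i /=; rewrite bmul_linl. Qed.
Fact es_mul_linr (a : EA) : linear (es_mul a).
Proof. by move=> c b b'; apply: esum_ext => i /=; rewrite bmul_linr. Qed.
Fact normr_es_mul (a b : EA) : `|es_mul a b| <= `|a| * `|b|.
Proof.
rewrite -[`|a|]/`|es_env a| mulrC -[`|b|]normr_id -normrZ.
apply: bsl_norm_le => i.
rewrite es_envE normr_id bsl_funZ es_envE normrM !normr_id mulrC.
apply: le_trans (normr_bmul _ _) _; apply: ler_wpM2l => //.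
by rewrite !nrmE lecR nrm_es_fun.
Qed.

HB.instance Definition _ := CompleteNormedModule_isBanachAlgebra.Build R EA
  es_mulA es_mul_linl es_mul_linr normr_es_mul.

End ESumAlgebra.

(* The E-sum of the constant family B. *)
Definition esum_const (R : realType) (I : Type) (E : banachSeqLattice R I)
  (B : banachAlgType R) : banachAlgType R := esum E (fun=> B).

Section C0.
Variables (R : realType) (I : Type).

Definition vanishing (x : I -> R[i]^o) : Prop :=
  forall e : R, 0 < e -> finite_set [set i | e <= nrm (x i)].

Record c0_space := C0 { c0_fun :> I -> R[i]^o; c0_vanishing : vanishing c0_fun }.

HB.instance Definition _ := gen_eqMixin c0_space.
HB.instance Definition _ := gen_choiceMixin c0_space.

Implicit Types x y : c0_space.

Lemma c0_ext x y : c0_fun x = c0_fun y -> x = y.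
Proof.
case: x y => [x hx] [y hy] /= xy; subst y.
by rewrite (Prop_irrelevance hx hy).
Qed.

Fact c0_0_vanishing : vanishing (fun _ => 0).
Proof.
move=> e e0; apply: sub_finite_set (@finite_set0 I) => i /=.
by rewrite nrm0 leNgt e0.
Qed.
Definition c0_0 := C0 c0_0_vanishing.

Fact c0_add_vanishing x y : vanishing (fun i => x i + y i).
Proof.
move=> e e0; have e20 : 0 < e / 2 by rewrite divr_gt0.
have : finite_set ([set i | e / 2 <= nrm (x i)] `|` [set i | e / 2 <= nrm (y i)]).
  by rewrite finite_setU; split; exact: c0_vanishing.
apply: sub_finite_set => i /= xye; apply: contrapT => /not_orP[].
move=> /negP; rewrite -ltNge => xe /negP; rewrite -ltNge => ye.
move: xye; apply/negP; rewrite -ltNge [ltRHS]splitr.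
by apply: le_lt_trans (ler_nrmD _ _) _; exact: ltrD.
Qed.
Definition c0_add x y := C0 (@c0_add_vanishing x y).

Fact c0_scale_vanishing (c : R[i]) x : vanishing (fun i => c *: x i).
Proof.
move=> e e0; have c1 : 0 < nrm (c : R[i]^o) + 1 by rewrite ltr_wpDl ?nrm_ge0.
have ec : 0 < e / (nrm (c : R[i]^o) + 1) by rewrite divr_gt0.
apply: sub_finite_set (c0_vanishing x ec) => i /=.
rewrite nrmZ ler_pdivrMr // => /le_trans; apply.
by rewrite mulrC ler_wpM2l ?nrm_ge0 // lerDl.
Qed.
Definition c0_scale (c : R[i]) x := C0 (@c0_scale_vanishing c x).

Definition c0_opp x := c0_scale (- 1) x.

Fact c0_addA : associative c0_add.
Proof. by move=> x y z; apply: c0_ext; apply: funext => i /=; rewrite addrA. Qed.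
Fact c0_addC : commutative c0_add.
Proof. by move=> x y; apply: c0_ext; apply: funext => i /=; rewrite addrC. Qed.
Fact c0_add0 : left_id c0_0 c0_add.
Proof. by move=> x; apply: c0_ext; apply: funext => i /=; rewrite add0r. Qed.
Fact c0_addN : left_inverse c0_0 c0_opp c0_add.
Proof.
by move=> x; apply: c0_ext; apply: funext => i /=; rewrite scaleN1r addNr.
Qed.

HB.instance Definition _ := GRing.isZmodule.Build c0_space
  c0_addA c0_addC c0_add0 c0_addN.

Fact c0_scaleA c d x : c0_scale c (c0_scale d x) = c0_scale (c * d) x.
Proof. by apply: c0_ext; apply: funext => i /=; rewrite scalerA. Qed.
Fact c0_scale1 : left_id 1 c0_scale.
Proof. by move=> x; apply: c0_ext; apply: funext => i /=; rewrite scale1r. Qed.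
Fact c0_scaleDr : right_distributive c0_scale +%R.
Proof. by move=> c x y; apply: c0_ext; apply: funext => i /=; rewrite scalerDr. Qed.
Fact c0_scaleDl x : {morph c0_scale^~ x : c d / c + d}.
Proof. by move=> c d; apply: c0_ext; apply: funext => i /=; rewrite scalerDl. Qed.

HB.instance Definition _ := GRing.Zmodule_isLmodule.Build R[i] c0_space
  c0_scaleA c0_scale1 c0_scaleDr c0_scaleDl.

Lemma finite_set_ubound (S : set I) (f : I -> R) : finite_set S ->
  exists M, forall i, S i -> f i <= M.
Proof.
move=> /(finite_image f)/finite_seqP[s sE].
exists (\sum_(r <- s) `|r|) => i Si.
have fs : [set` s] (f i) by rewrite -sE; exists i.
rewrite (big_rem _ fs) /=; apply: le_trans (ler_norm _) _.
by rewrite lerDl sumr_ge0.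
Qed.

Lemma c0_linf x : linf x.
Proof.
have [M HM] := finite_set_ubound (fun i => nrm (x i)) (c0_vanishing x ltr01).
exists (Num.max M 1) => i; rewrite le_max.
by case: (leP 1 (nrm (x i))) => [/HM ->//|/ltW ->]; rewrite orbT.
Qed.

Lemma nrm_c0_fun x i : nrm (x i) <= linf_norm x.
Proof. exact/nrm_le_linf_norm/c0_linf. Qed.

Lemma linf_norm_ge0 (y : I -> R[i]^o) : 0 <= linf_norm y.
Proof.
rewrite /linf_norm; set S := (S in sup S).
have [[r [i _ ri]]|S0] := pselect (S !=set0).
  have [Sub|/sup_out->//] := pselect (has_sup S).
  apply: le_trans (nrm_ge0 (y i)) _; apply: ub_le_sup; first by case: Sub.
  by exists i.
by rewrite sup_out // => -[].
Qed.

Fact c0_normD x y :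
  (linf_norm (x + y))%:C <= (linf_norm x)%:C + (linf_norm y)%:C.
Proof.
rewrite -rmorphD lecR; apply: linf_norm_le.
  by rewrite addr_ge0 ?linf_norm_ge0.
move=> i /=; apply: le_trans (ler_nrmD _ _) _.
by rewrite lerD ?nrm_c0_fun.
Qed.
Lemma c0_normZ_le (c : R[i]) x :
  linf_norm (c *: x) <= nrm (c : R[i]^o) * linf_norm x.
Proof.
apply: linf_norm_le; first by rewrite mulr_ge0 ?linf_norm_ge0 ?nrm_ge0.
by move=> i /=; rewrite nrmZ ler_wpM2l ?nrm_ge0 ?nrm_c0_fun.
Qed.
Fact c0_normZ (c : R[i]) x : (linf_norm (c *: x))%:C = `|c| * (linf_norm x)%:C.
Proof.
rewrite (nrmE (c : R[i]^o)) -rmorphM; congr (_%:C).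
apply: le_anti; rewrite c0_normZ_le /=.
have [->|c0] := eqVneq c 0; first by rewrite nrm0 mul0r linf_norm_ge0.
have nc : 0 < nrm (c : R[i]^o).
  by rewrite lt_def nrm_ge0 andbT; apply: contra_neq c0 => /nrm0_eq0.
rewrite -ler_pdivlMl //; apply: linf_norm_le.
  by rewrite mulr_ge0 ?linf_norm_ge0 // invr_ge0 ltW.
by move=> i; rewrite ler_pdivlMl // -nrmZ; exact: (nrm_c0_fun (c *: x)).
Qed.
Fact c0_norm0_eq0 x : (linf_norm x)%:C = 0 -> x = 0.
Proof.
move=> /(@complexI R) x0; apply: c0_ext; apply: funext => i /=.
by apply: nrm0_eq0; apply: le_anti; rewrite nrm_ge0 andbT -x0 nrm_c0_fun.
Qed.

HB.instance Definition _ := Lmodule_isNormed.Build R[i] c0_space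
  c0_normD c0_normZ c0_norm0_eq0.

Lemma nrm_c0 x : nrm x = linf_norm x.
Proof. by []. Qed.

Lemma c0B x y i : (x - y) i = x i - y i.
Proof. by rewrite -[- y]/(c0_opp y) /= scaleN1r. Qed.

Fact c0_complete (F : set_system c0_space) :
  ProperFilter F -> cauchy F -> cvg F.
Proof.
apply: cauchy_seq_complete => u uc.
have /choice[l ul] : forall i, exists z,
    cvg_for (@nrm R R[i]^o) (fun n => u n i) z.
  move=> i; apply: complex_complete => d /uc[N HN]; exists N => m n Nm Nn.
  by apply: le_lt_trans (HN m n Nm Nn); rewrite -c0B nrm_c0 nrm_c0_fun.
have close d : 0 < d ->
    exists N, forall n i, (N <= n)%N -> nrm (u n i - l i) <= d.
  move=> d0; have d20 : 0 < d / 2 by rewrite divr_gt0.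
  have [N HN] := uc _ d20; exists N => n i Nn.
  have [M HM] := ul i _ d20.
  rewrite -(subrKA (u (maxn N M) i)) [leRHS]splitr.
  apply: le_trans (ler_nrmD _ _) _; apply: lerD; last first.
    by apply/ltW/HM; rewrite leq_maxr.
  apply: le_trans (ltW (HN n (maxn N M) Nn (leq_maxl _ _))).
  by rewrite -c0B nrm_c0 nrm_c0_fun.
have lv : vanishing l.
  move=> d d0; have d20 : 0 < d / 2 by rewrite divr_gt0.
  have [N HN] := close _ d20.
  apply: sub_finite_set (c0_vanishing (u N) d20) => i /= dl.
  rewrite -(lerD2r (d / 2)) -splitr; apply: le_trans dl _.
  rewrite -[l i](subrK (u N i)) addrC; apply: le_trans (ler_nrmD _ _) _.
  by rewrite lerD2l nrm_distC HN.
exists (C0 lv) => d d0; have d20 : 0 < d / 2 by rewrite divr_gt0.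
have [N HN] := close _ d20; exists N => n Nn.
apply: (@le_lt_trans _ _ (d / 2)); last by rewrite ltr_pdivrMr // ltr_pMr // ltr1n.
apply: linf_norm_le; first exact: ltW.
by move=> i; rewrite c0B; exact: HN.
Qed.

HB.instance Definition _ := Uniform_isComplete.Build c0_space c0_complete.

Fact c0_fun_linear : linear (c0_fun : c0_space -> (I -> R[i]^o)).
Proof. by []. Qed.

Fact c0_c00 (x : I -> R[i]^o) : finite_supp x -> exists e, c0_fun e = x.
Proof.
move=> xf; have xv : vanishing x.
  move=> e e0; apply: sub_finite_set xf => i /= ex.
  by apply: contraTneq ex => ->; rewrite nrm0 -ltNge.
by exists (C0 xv).
Qed.

Fact c0_dense : dense [set e : c0_space | finite_supp (c0_fun e)].
Proof.
move=> O [x Ox] oO; have /nbhs_ballP[r r0 xr] : nbhs x O by apply: open_nbhs_nbhs.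
have rr : (complex.Re r)%:C = r by rewrite RRe_real // gtr0_real.
have r0' : 0 < complex.Re r by rewrite -ltcR rr.
have r20 : 0 < complex.Re r / 2 by rewrite divr_gt0.
pose S := [set i | complex.Re r / 2 <= nrm (x i)].
have Sf : finite_set S by exact: c0_vanishing.
pose y i : R[i]^o := if pselect (S i) then x i else 0.
have yS : finite_supp y.
  apply: sub_finite_set Sf => i /=; rewrite /y.
  by case: pselect => [Si|nSi] /=; [move=> _; exact: Si|rewrite eqxx].
have [e ey] := c0_c00 yS; exists e; split; last by rewrite /= ey.
apply: xr; rewrite -ball_normE /= -rr nrmE ltcR nrm_c0.
apply: (@le_lt_trans _ _ (complex.Re r / 2)).
  apply: linf_norm_le; first exact: ltW.
  move=> i; rewrite c0B ey /y; case: pselect => [Si|nSi] /=; first by rewrite subrr nrm0 ltW.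
  by move/negP: nSi; rewrite -ltNge subr0 => /ltW.
by rewrite ltr_pdivrMr // ltr_pMr // ltr1n.
Qed.

Fact c0_solid (y : c0_space) (x : I -> R[i]^o) : linf x ->
  (forall i, `|x i| <= `|y i|) -> exists2 e : c0_space, c0_fun e = x & `|e| <= `|y|.
Proof.
move=> _ xy; have {}xy i : nrm (x i) <= nrm (y i) by rewrite -lecR -!nrmE.
have xv : vanishing x.
  move=> e e0; apply: sub_finite_set (c0_vanishing y e0) => i /=.
  by move/le_trans; apply.
exists (C0 xv) => //; rewrite !nrmE lecR; apply: linf_norm_le.
  exact: linf_norm_ge0.
by move=> i; apply: le_trans (xy i) (nrm_c0_fun _ _).
Qed.

(* c_0(I) with the supremum norm. *)
Definition c0_lattice : banachSeqLattice R I :=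
  @BanachSeqLattice R I c0_space c0_fun c0_fun_linear c0_ext c0_c00 c0_linf
    c0_dense c0_solid (fun e => lexx _).

End C0.

(* Main.v *)
(* Each coordinate projection of B^(E) is a contractive surjective homomorphism,
   and its second adjoint pushes virtual diagonals of B^(E) to virtual diagonals
   of B. Conversely, let M be a virtual diagonal of B and inj_i the coordinate
   embeddings. The sum of inj_i (x) inj_i over a finite set F is an average, over
   signs u on F, of the maps x (x) y |-> (u x) (x) (u y), so its norm is at most
   C_E^2. The images of M under the second adjoints of these sums are
   therefore bounded by C_E^2 ||M||, and a weak-* limit of them along an
   ultrafilter refining the net of finite sets is a virtual diagonal: they commute
   exactly with B^(E), and they send a to its truncation to F, which converges
   to a because c_00 is dense in E. *)
Require Import Defs.
From mathcomp Require Import all_boot all_order all_algebra.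
From mathcomp Require Import complex.
From mathcomp Require Import all_classical all_reals all_analysis.

Set Implicit Arguments.
Unset Strict Implicit.
Unset Printing Implicit Defensive.

Import Order.TTheory GRing.Theory Num.Theory.
Import numFieldNormedType.Exports.

Local Open Scope classical_set_scope.

(** * Limits along an ultrafilter and weak-* compactness *)

Section BanachAlaoglu.
Local Open Scope complex_scope.
Local Open Scope ring_scope.
Variables (R : realType) (T : Type) (U : set_system T).
Hypothesis UU : UltraFilter U.

(** The compact segment from [- K] to [K] supplies a cluster point, and an ultrafilter converges to
    each of its cluster points. *)
Lemma ultra_bounded_real_cvg (f : T -> R) (K : R) :
  (forall t, `|f t| <= K) -> exists a : R, f @ U --> a.
Proof.
move=> fK; have UP : ProperFilter U by exact: ultra_proper.
have [|a [_ aU]] := @segment_compact R (- K) K (f @ U) _.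
  by apply: nearW => t /=; rewrite in_itv /= -ler_norml.
(* If the preimage of the neighbourhood [B] were not in [U], its complement would be, and a cluster
   point would force [B] to meet its own complement. *)
exists a => B aB; have [//|nB] := in_ultra_setVsetC (f @^-1` B) UU.
by have [r [rnB rB]] := aU (~` B) B nB aB.
Qed.

Lemma ultra_bounded_complex_cvg (z : T -> R[i]^o) (K : R) :
  (forall t, nrm (z t) <= K) -> exists l : R[i]^o, z @ U --> l.
Proof.
move=> zK; have UP : ProperFilter U by exact: ultra_proper.
have [t|a ua] := @ultra_bounded_real_cvg (fun t => complex.Re (z t)) K.
  exact: le_trans (nrm_Re _) (zK t).
have [t|b ub] := @ultra_bounded_real_cvg (fun t => complex.Im (z t)) K.
  exact: le_trans (nrm_Im _) (zK t).
exists (a +i* b); apply/cvgrPdist_lt => e e0.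
have er : (complex.Re e)%:C = e by rewrite RRe_real // gtr0_real.
have e20 : 0 < complex.Re e / 2 by rewrite divr_gt0 // -ltcR er.
near=> t; have at_ : `|a - complex.Re (z t)| < complex.Re e / 2.
  by near: t; exact: (iffLR (cvgrPdist_lt _ _) ua _ e20).
have bt : `|b - complex.Im (z t)| < complex.Re e / 2.
  by near: t; exact: (iffLR (cvgrPdist_lt _ _) ub _ e20).
rewrite -er nrmE ltcR; apply: le_lt_trans (nrm_le_ReIm _) _.
by rewrite [ltRHS]splitr !raddfB /= ltrD.
Unshelve. all: by end_near. Qed.

Lemma ultra_limit_nrm_le (V : normedModType R[i]) (z : T -> V) (l : V) (K : R) :
  (forall t, nrm (z t) <= K) -> z @ U --> l -> nrm l <= K.
Proof.
move=> zK zl; have UP : ProperFilter U by exact: ultra_proper.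
apply/ler_addgt0Pr => e e0.
have ec : (0 : R[i]) < e%:C by rewrite ltcR.
have /filter_ex[t] : \forall t \near U, `|l - z t| < e%:C.
  exact: (iffLR (cvgrPdist_lt _ _) zl _ ec).
rewrite nrmE ltcR => lt_e; rewrite -[l](subrK (z t)) addrC.
by apply: le_trans (ler_nrmD _ _) (lerD (zK t) (ltW lt_e)).
Qed.

(** Every orbit [f t v] is bounded by [K * nrm v], so it has a limit along [U]; linearity and the
    bound pass to these pointwise limits. *)
Lemma banach_alaoglu (V : normedModType R[i]) (f : T -> dual V) (K : R) :
  0 <= K -> (forall t, opnorm (f t) <= K) ->
  exists2 g : dual V, opnorm g <= K & forall v, (fun t => f t v) @ U --> g v.
Proof.
move=> K0 fK; have UP : ProperFilter U by exact: ultra_proper.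
have fKv t v : nrm (f t v) <= K * nrm v.
  by apply: le_trans (ler_opnorm _ _) _; rewrite ler_wpM2r ?nrm_ge0.
have /choice[g fg] v : exists l : R[i]^o, (fun t => f t v) @ U --> l.
  exact: (ultra_bounded_complex_cvg (fun t => fKv t v)).
have gl : linear g.
  move=> c x y; apply: (cvg_unique (@norm_hausdorff _ _) (fg (c *: x + y))).
  rewrite (_ : (fun t => _) = (fun t => c *: f t x + f t y)); last first.
    by apply: funext => t; rewrite linearP.
  by apply: cvgD (fg y); apply: cvgZr; exact: fg.
have gK v : nrm (g v) <= K * nrm v.
  exact: ultra_limit_nrm_le (fun t => fKv t v) (fg v).
exists (Blin gl (ex_intro _ K gK)) => //.
exact: opnorm_le.
Qed.

End BanachAlaoglu.

(** * Tensor products of bounded maps *)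

Section ProjectiveTensorMaps.
Local Open Scope complex_scope.
Local Open Scope ring_scope.
Variable R : realType.

Fact blin_comp_linear (U V W : normedModType R[i]) (S : blin V W) (T : blin U V) :
  linear (fun x => S (T x)).
Proof. by move=> c x y; rewrite !linearP. Qed.
Fact blin_comp_bounded (U V W : normedModType R[i]) (S : blin V W) (T : blin U V) :
  exists M : R, forall x, nrm (S (T x)) <= M * nrm x.
Proof.
exists (opnorm S * opnorm T) => x; apply: le_trans (ler_opnorm _ _) _.
by rewrite -mulrA ler_wpM2l ?opnorm_ge0 ?ler_opnorm.
Qed.
Definition blin_comp (U V W : normedModType R[i]) (S : blin V W) (T : blin U V) :=
  Blin (blin_comp_linear S T) (blin_comp_bounded S T).

Lemma opnorm_biadjoint_le (V W : normedModType R[i]) (T : blin V W)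
    (M : bidual V) : nrm (biadjoint T M) <= opnorm T * nrm M.
Proof.
rewrite !nrm_blin; apply: opnorm_le => [|f].
  by rewrite mulr_ge0 ?opnorm_ge0.
apply: le_trans (ler_opnorm M _) _.
rewrite [opnorm T * _]mulrC -mulrA ler_wpM2l ?opnorm_ge0 //.
rewrite !nrm_blin; apply: opnorm_le => [|x].
  by rewrite mulr_ge0 ?opnorm_ge0.
apply: le_trans (ler_opnorm f (T x)) _.
by rewrite [opnorm T * _]mulrC -mulrA ler_wpM2l ?opnorm_ge0 ?ler_opnorm.
Qed.

Section Ext.
Variables A B W : normedModType R[i].

(** Elementary tensors span the algebraic tensor product, which is dense in its completion, and
    bounded maps are continuous. *)
Lemma ptensor_ext (S T : blin (ptensor A B) W) :
  (forall x y, S (ptens x y) = T (ptens x y)) -> forall u, S u = T u.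
Proof.
move=> ST u; apply/subr0_eq/nrm0_eq0/le_anti; rewrite nrm_ge0 andbT.
have STin v : S (compl_in (proj_seminorm A B) v) = T (compl_in (proj_seminorm A B) v).
  elim/tens_ind: v; elim=> [|[x y] l IHl].
    by rewrite (_ : compl_in _ _ = 0) // !linear0.
  rewrite -cat1s -tens_sumD -[tens_sum [:: _]]scale1r compl_in_linear.
  by rewrite !linearP; congr (_ *: _ + _); [exact: ST|exact: IHl].
have STu : nrm (S u - T u) = nrm ((S - T) u) by [].
have {}STin v : (S - T) (compl_in (proj_seminorm A B) v) = 0.
  by rewrite -[LHS]/(S _ - T _) STin subrr.
rewrite STu; apply/ler_addgt0Pr => e e0; rewrite add0r.
(* The added 1 keeps the divisor positive even when [S - T] has norm 0. *)
have k1 : 0 < opnorm (S - T) + 1 by rewrite ltr_wpDl ?opnorm_ge0.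
have [|v uv] := compl_in_dense u (e := e / (opnorm (S - T) + 1)).
  by rewrite divr_gt0.
have -> : (S - T) u = (S - T) (u - compl_in (proj_seminorm A B) v).
  apply/esym; apply: etrans (linearB (S - T) _ _) _.
  by apply: etrans (congr1 (fun w => (S - T) u - w) (STin v)) (subr0 _).
apply: le_trans (ler_opnorm _ _) _.
move: uv; rewrite ltr_pdivlMr // => /ltW; apply: le_trans.
by rewrite mulrC ler_wpM2l ?nrm_ge0 // lerDl.
Qed.

End Ext.

Section Map.
Variables (A A' B B' : normedModType R[i]) (S : blin A A') (T : blin B B').

Let map_fun (x : A) (y : B) : ptensor A' B' := ptens (S x) (T y).
Fact ptens_map_linl y : linear (map_fun^~ y).
Proof. by move=> c x x'; rewrite /map_fun linearP ptens_linl. Qed.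
Fact ptens_map_linr x : linear (map_fun x).
Proof. by move=> c y y'; rewrite /map_fun linearP ptens_linr. Qed.
Lemma ptens_map_bound x y :
  nrm (map_fun x y) <= opnorm S * opnorm T * (nrm x * nrm y).
Proof.
apply: le_trans (nrm_ptens_le _ _) _.
by rewrite mulrACA ler_pM ?nrm_ge0 ?ler_opnorm.
Qed.
Fact ptens_map_bounded :
  exists2 M : R, 0 <= M & forall x y, nrm (map_fun x y) <= M * (nrm x * nrm y).
Proof.
exists (opnorm S * opnorm T); last exact: ptens_map_bound.
by rewrite mulr_ge0 ?opnorm_ge0.
Qed.

Definition ptens_map : blin (ptensor A B) (ptensor A' B') :=
  ptens_lift (BBilin ptens_map_linl ptens_map_linr ptens_map_bounded).

Lemma ptens_mapE x y : ptens_map (ptens x y) = ptens (S x) (T y).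
Proof. exact: ptens_liftE. Qed.

(** The constant of the bilinear map passes unchanged to the projective norm on finite sums, and
    then to the completion. *)
Lemma opnorm_ptens_map : opnorm ptens_map <= opnorm S * opnorm T.
Proof.
have ST0 : 0 <= opnorm S * opnorm T by rewrite mulr_ge0 ?opnorm_ge0.
apply: opnorm_le => // x; apply: extension_bound.
- exact: tens_lift_bbilin_linear.
- exact: tens_lift_bbilin_bounded.
- by apply: tens_lift_bound => // y z; exact: ptens_map_bound.
Qed.

End Map.
End ProjectiveTensorMaps.

(** * Transport of virtual diagonals by homomorphisms *)

Section VirtualDiagonals.
Local Open Scope complex_scope.
Local Open Scope ring_scope.
Variable R : realType.

(** Functoriality of the second adjoint: an identity checked on the spaces themselves, hence on
    elementary tensors, transfers to every element of the bidual. *)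
Lemma biadjoint_square (V W W' Z : normedModType R[i]) (S : blin V W)
    (T : blin W Z) (S' : blin V W') (T' : blin W' Z) (M : bidual V) :
  (forall x, T (S x) = T' (S' x)) ->
  biadjoint T (biadjoint S M) = biadjoint T' (biadjoint S' M).
Proof.
move=> TS; apply: blin_ext => f; rewrite /=; congr (M _).
by apply: blin_ext => x /=; rewrite TS.
Qed.

Lemma biadjoint_evaluation (V W : normedModType R[i]) (T : blin V W) (x : V) :
  biadjoint T (evaluation x) = evaluation (T x).
Proof. exact: blin_ext. Qed.

Lemma biadjointD (V W : normedModType R[i]) (S T : blin V W) (M : bidual V) :
  biadjoint (S + T) M = biadjoint S M + biadjoint T M.
Proof.
apply: blin_ext => f; rewrite [RHS]/= -linearD; congr (M _).
by apply: blin_ext => x /=; rewrite linearD.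
Qed.

Lemma biadjoint0 (V W : normedModType R[i]) (M : bidual V) :
  biadjoint (0 : blin V W) M = 0.
Proof.
apply: blin_ext => f; rewrite [RHS]/= -(linear0 M); congr (M _).
by apply: blin_ext => x /=; rewrite linear0.
Qed.

Lemma biadjoint_sum (J : Type) (V W : normedModType R[i]) (r : seq J)
    (T : J -> blin V W) (M : bidual V) :
  biadjoint (\sum_(j <- r) T j) M = \sum_(j <- r) biadjoint (T j) M.
Proof.
apply: (big_morph (fun T => biadjoint T M)) => [S S'|].
- exact: biadjointD.
- exact: biadjoint0.
Qed.

Lemma blin_compE (U V W : normedModType R[i]) (S : blin V W) (T : blin U V) x :
  blin_comp S T x = S (T x).
Proof. by []. Qed.

Lemma lactE (A : banachAlgType R) (a x y : A) :
  lact a (ptens x y) = ptens (bmul a x) y.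
Proof. exact: ptens_liftE. Qed.

Lemma ractE (A : banachAlgType R) (a x y : A) :
  ract a (ptens x y) = ptens x (bmul y a).
Proof. exact: ptens_liftE. Qed.

Lemma prod_mapE (A : banachAlgType R) (x y : A) :
  prod_map A (ptens x y) = bmul x y.
Proof. exact: ptens_liftE. Qed.

Section Intertwining.
Variables A A' : banachAlgType R.

(** The left action touches only the first tensor factor, so only [S] has to intertwine. *)
Lemma ptens_map_lact (S T : blin A A') (a : A) (a' : A') :
  (forall x, S (bmul a x) = bmul a' (S x)) ->
  forall u, ptens_map S T (lact a u) = lact a' (ptens_map S T u).
Proof.
move=> Sa u.
apply: (ptensor_ext (S := blin_comp (ptens_map S T) (lact a))
  (T := blin_comp (lact a') (ptens_map S T))) => x y.
by rewrite !blin_compE lactE !ptens_mapE lactE Sa.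
Qed.

Lemma ptens_map_ract (S T : blin A A') (a : A) (a' : A') :
  (forall y, T (bmul y a) = bmul (T y) a') ->
  forall u, ptens_map S T (ract a u) = ract a' (ptens_map S T u).
Proof.
move=> Ta u.
apply: (ptensor_ext (S := blin_comp (ptens_map S T) (ract a))
  (T := blin_comp (ract a') (ptens_map S T))) => x y.
by rewrite !blin_compE ractE !ptens_mapE ractE Ta.
Qed.

Variable S : blin A A'.
Hypothesis S_mul : forall x y, S (bmul x y) = bmul (S x) (S y).

Lemma prod_map_ptens_map u : prod_map A' (ptens_map S S u) = S (prod_map A u).
Proof.
apply: (ptensor_ext (S := blin_comp (prod_map A') (ptens_map S S))
  (T := blin_comp S (prod_map A))) => x y.
by rewrite !blin_compE ptens_mapE !prod_mapE S_mul.
Qed.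

(** Surjectivity writes each [a'] as [S a]; the identities of [M] for [a] are then carried over by
    commuting squares. *)
Lemma virtual_diagonal_push (M : bidual (ptensor A A)) :
  (forall a', exists a, S a = a') -> virtual_diagonal M ->
  virtual_diagonal (biadjoint (ptens_map S S) M).
Proof.
move=> S_surj [Mc Mu]; split=> a'; have [a <-] := S_surj a'.
  rewrite -(biadjoint_square (S := lact a) (T := ptens_map S S)); last first.
    by apply: ptens_map_lact => x; rewrite S_mul.
  rewrite Mc; apply: biadjoint_square.
  by apply: ptens_map_ract => x; rewrite S_mul.
rewrite (biadjoint_square (T' := S) (S' := prod_map A)); last first.
  exact: prod_map_ptens_map.
have [Ml Mr] := Mu a; split.
  rewrite (biadjoint_square (T' := S) (S' := lmul a)) => [|x]; last first.
    by rewrite /= S_mul.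
  by rewrite Ml biadjoint_evaluation.
rewrite [RHS](biadjoint_square (T' := S) (S' := rmul a)) => [|x]; last first.
  by rewrite /= S_mul.
by rewrite -Mr biadjoint_evaluation.
Qed.

(** Since [S] is a contraction, so is [ptens_map S S], and pushing a virtual diagonal forward does
    not increase its norm. *)
Lemma AM_push : opnorm S <= 1 -> (forall a', exists a, S a = a') ->
  (AM A' <= AM A)%E.
Proof.
move=> S1 S_surj; apply: le_ereal_inf_tmp => _ [M MA <-].
apply: ge_ereal_inf; exists (nrm (biadjoint (ptens_map S S) M))%:E.
  by exists (biadjoint (ptens_map S S) M) => //; exact: virtual_diagonal_push.
rewrite lee_fin; apply: le_trans (opnorm_biadjoint_le _ _) _.
rewrite ler_piMl ?nrm_ge0 //; apply: le_trans (opnorm_ptens_map _ _) _.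
by rewrite mulr_ile1 ?opnorm_ge0.
Qed.

End Intertwining.

Section PtensAdd.
Variables V W : normedModType R[i].

Lemma ptensDl (u v : V) (w : W) : ptens (u + v) w = ptens u w + ptens v w.
Proof. by have := ptens_linl w 1 u v; rewrite !scale1r. Qed.

Lemma ptensDr (u : V) (v w : W) : ptens u (v + w) = ptens u v + ptens u w.
Proof. by have := ptens_linr u 1 v w; rewrite !scale1r. Qed.

Lemma ptens0l (w : W) : ptens (0 : V) w = 0.
Proof. by apply: (addrI (ptens 0 w)); rewrite -ptensDl !addr0. Qed.

Lemma ptens0r (u : V) : ptens u (0 : W) = 0.
Proof. by apply: (addrI (ptens u 0)); rewrite -ptensDr !addr0. Qed.

Lemma ptensNl (u : V) (w : W) : ptens (- u) w = - ptens u w.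
Proof. by apply/eqP; rewrite -addr_eq0 -ptensDl addNr ptens0l. Qed.

Lemma ptensNr (u : V) (w : W) : ptens u (- w) = - ptens u w.
Proof. by apply/eqP; rewrite -addr_eq0 -ptensDr addNr ptens0r. Qed.

End PtensAdd.

(** The mixed terms in [S] and [T] have opposite signs in the two squares and cancel. *)
Lemma ptens_map_parallelogram (V W : normedModType R[i]) (S T : blin V W) :
  ptens_map (S + T) (S + T) + ptens_map (S - T) (S - T) =
  (ptens_map S S + ptens_map T T) *+ 2.
Proof.
apply: blin_ext; apply: ptensor_ext => x y; rewrite mulr2n.
rewrite [LHS]/(ptens_map _ _ _ + ptens_map _ _ _).
rewrite [RHS]/((ptens_map _ _ _ + ptens_map _ _ _)
  + (ptens_map _ _ _ + ptens_map _ _ _)).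
rewrite !ptens_mapE.
rewrite -[(S + T) x]/(S x + T x) -[(S + T) y]/(S y + T y).
rewrite -[(S - T) x]/(S x - T x) -[(S - T) y]/(S y - T y).
rewrite !(ptensDl, ptensDr, ptensNl, ptensNr) opprK.
set a := ptens (S x) (S y); set b := ptens (T x) (T y).
have par (Z : zmodType) (z p q w : Z) :
    z + p + (q + w) + (z - p + (- q + w)) = z + w + (z + w).
  by rewrite addrACA (addrACA z) subrr addr0 (addrACA q) subrr add0r addrACA.
exact: par.
Qed.
End VirtualDiagonals.

(** * Midpoints in a ball of operators *)

Section Midpoint.
Local Open Scope complex_scope.
Local Open Scope ring_scope.

Lemma opnorm_midpoint (R : realType) (V W : normedModType R[i])
    (X Y Z : blin V W) (K : R) :
  X *+ 2 = Y + Z -> opnorm Y <= K -> opnorm Z <= K -> opnorm X <= K.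
Proof.
move=> XYZ YK ZK; have n2 : nrm (2 : R[i]^o) = 2.
  by rewrite (_ : 2 = 2%:C) ?nrm_real // rmorphMn.
have : opnorm (X *+ 2) <= K *+ 2.
  by rewrite XYZ mulr2n; apply: le_trans (opnormD _ _) (lerD YK ZK).
by rewrite -scaler_nat opnormZ n2 -[K *+ 2]mulr_natl ler_pM2l.
Qed.

(** Shape of an induction step: [p] is the square of the current vector, [q] that of the new
    coordinate, [d] the sum still to be absorbed. *)
Lemma mulr2n_midpoint (Z : zmodType) (a b p q d : Z) :
  a + b = (p + q) *+ 2 -> (p + (q + d)) *+ 2 = (a + d) + (b + d).
Proof. by move=> ab; rewrite addrA mulrnDl -ab mulr2n addrACA. Qed.

End Midpoint.

(** * Embeddings, coordinates and the norm of the diagonal sums *)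

Section LatticeSum.
Local Open Scope complex_scope.
Local Open Scope ring_scope.
Variables (R : realType) (I : choiceType) (E : banachSeqLattice R I).
Variable B : banachAlgType R.

Local Notation EB := (esum_const E B).

Section Scalars.
Variable u : E.

Fact smul_in (x : B) : in_esum E (fun j => bsl_fun u j *: x).
Proof.
apply: (@in_esum_dominated _ _ _ _ _ (`|x| *: u)) => j.
by rewrite bsl_funZ normrM normr_id normrZ mulrC.
Qed.

Definition smul_fun (x : B) : EB := ESum (smul_in x).

Fact smul_linear : linear smul_fun.
Proof.
move=> c x y; apply: esum_ext => j /=.
by rewrite scalerDr !scalerA mulrC.
Qed.

Lemma nrm_smul (x : B) : nrm (smul_fun x) <= nrm u * nrm x.
Proof.
rewrite -lecR rmorphM /= -!nrmE mulrC -[`|x|]normr_id -normrZ.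
apply: bsl_norm_le => j.
by rewrite es_envE bsl_funZ normrM !normr_id normrZ mulrC.
Qed.

Fact smul_bounded : exists K : R, forall x, nrm (smul_fun x) <= K * nrm x.
Proof. by exists (nrm u) => x; exact: nrm_smul. Qed.

(** One family, linear in [u], covers the coordinate embeddings and all their signed sums; its norm
    is controlled by that of [u] in [E]. *)
Definition es_smul : blin B EB := Blin smul_linear smul_bounded.

Lemma opnorm_smul : opnorm es_smul <= nrm u.
Proof. by apply: opnorm_le; [exact: nrm_ge0|exact: nrm_smul]. Qed.

Lemma es_smulE (x : B) j : es_smul x j = bsl_fun u j *: x.
Proof. by []. Qed.

End Scalars.

Lemma es_smulD (u v : E) : es_smul (u + v) = es_smul u + es_smul v.
Proof.
apply: blin_ext => x; apply: esum_ext => j.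
by rewrite es_smulE bsl_funD scalerDl.
Qed.

Lemma es_smulB (u v : E) : es_smul (u - v) = es_smul u - es_smul v.
Proof.
apply: blin_ext => x; apply: esum_ext => j.
by rewrite es_smulE bsl_funB scalerBl.
Qed.

Lemma es_smul0 : es_smul 0 = 0.
Proof.
apply: blin_ext => x; apply: esum_ext => j.
by rewrite es_smulE bsl_fun0 scale0r.
Qed.

Lemma finite_supp_pred1 (i : I) :
  finite_supp (fun j => (j == i)%:R : R[i]^o).
Proof.
apply: sub_finite_set (finite_set1 i) => j /=.
by case: (eqVneq j i) => [->|] //; rewrite eqxx.
Qed.

Definition unit_vec (i : I) : E := sval (cid (bsl_c00 E (finite_supp_pred1 i))).

Lemma unit_vecE i j : bsl_fun (unit_vec i) j = (j == i)%:R.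
Proof. by rewrite /unit_vec; case: cid => e /= ->. Qed.

Definition es_inj (i : I) : blin B EB := es_smul (unit_vec i).

Lemma es_injE i x j : es_inj i x j = if j == i then x else 0.
Proof.
by rewrite /es_inj es_smulE unit_vecE; case: (j == i); rewrite ?scale1r ?scale0r.
Qed.

Fact coord_linear i : linear (fun a : EB => a i : B).
Proof. by []. Qed.
Fact coord_bounded i : exists K : R, forall a : EB, nrm (a i : B) <= K * nrm a.
Proof. by exists 1 => a; apply: le_trans (nrm_es_fun _ _) _; rewrite mul1r. Qed.
Definition es_coord i : blin EB B := Blin (@coord_linear i) (coord_bounded i).

Lemma opnorm_coord i : opnorm (es_coord i) <= 1.
Proof. by apply: opnorm_le => // a; rewrite mul1r; exact: nrm_es_fun. Qed.

Lemma es_coord_inj i x : es_coord i (es_inj i x) = x.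
Proof. by rewrite -[LHS]/(es_inj i x i) es_injE eqxx. Qed.

Lemma bmul0l (x : B) : bmul 0 x = 0.
Proof. exact: (linear0 (rmul x)). Qed.

Lemma bmul0r (x : B) : bmul x 0 = 0.
Proof. exact: (linear0 (lmul x)). Qed.

(** Off the index [i] both sides vanish: on the [i]-th copy of [B], [a] acts through its coordinate
    [a i]. *)
Lemma es_inj_bmull i (a : EB) x : es_inj i (bmul (a i) x) = bmul a (es_inj i x).
Proof.
apply: esum_ext => j; rewrite [RHS]/(bmul (a j) (es_inj i x j)) !es_injE.
by case: eqVneq => [->//|_]; exact/esym/bmul0r.
Qed.

Lemma es_inj_bmulr i (a : EB) x : es_inj i (bmul x (a i)) = bmul (es_inj i x) a.
Proof.
apply: esum_ext => j; rewrite [RHS]/(bmul (es_inj i x j) (a j)) !es_injE.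
by case: eqVneq => [->//|_]; exact/esym/bmul0l.
Qed.

Lemma es_inj_bmul i x y : es_inj i (bmul x y) = bmul (es_inj i x) (es_inj i y).
Proof. by rewrite -es_inj_bmull es_injE eqxx. Qed.

(** The coordinate projection at [i] is a contractive homomorphism, onto because [es_inj] is a
    section of it. *)
Lemma AM_le_esum_const (i : I) : (AM B <= AM EB)%E.
Proof.
apply: (@AM_push _ _ _ (es_coord i)) => //; first exact: opnorm_coord.
by move=> x; exists (es_inj i x); exact: es_coord_inj.
Qed.

Lemma amenable_of_esum_const (i : I) : amenable EB -> amenable B.
Proof.
move=> [M MV]; exists (biadjoint (ptens_map (es_coord i) (es_coord i)) M).
apply: virtual_diagonal_push => // x.
by exists (es_inj i x); exact: es_coord_inj.
Qed.

Section DiagonalBound.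
Variable C : R.
Hypothesis C_bound : forall e : E, finite_supp (bsl_fun e) ->
  (forall j, nrm (bsl_fun e j) <= 1) -> nrm e <= C.

(* The sum over s is absorbed one index at a time: by the parallelogram
   identity, u (x) u + e_i (x) e_i is the mean of (u + e_i) (x) (u + e_i) and
   (u - e_i) (x) (u - e_i), and u + e_i, u - e_i are again bounded by 1. *)
Lemma opnorm_square_diagonal (s : seq I) (u : E) : uniq s ->
  (forall i, i \in s -> bsl_fun u i = 0) -> finite_supp (bsl_fun u) ->
  (forall j, nrm (bsl_fun u j) <= 1) ->
  opnorm (ptens_map (es_smul u) (es_smul u) +
          \sum_(i <- s) ptens_map (es_inj i) (es_inj i)) <= C ^+ 2.
Proof.
elim: s u => [|i s IHs] u.
  move=> _ _ uf u1; rewrite big_nil addr0.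
  (* The bound by [C] is used once per tensor factor, whence the square. *)
  apply: le_trans (opnorm_ptens_map _ _) _; rewrite expr2.
  have uC := le_trans (opnorm_smul u) (C_bound uf u1).
  by apply: ler_pM; rewrite ?opnorm_ge0.
move=> /= /andP[i_s us] u0 uf u1; rewrite big_cons.
(* The induction hypothesis applies to any [v] that changes [u] only at [i]: as [i] is not in [s],
   such a [v] still vanishes on [s]. *)
have vP (v : E) : (forall j, j != i -> bsl_fun v j = bsl_fun u j) ->
    nrm (bsl_fun v i) <= 1 ->
  opnorm (ptens_map (es_smul v) (es_smul v) +
          \sum_(i <- s) ptens_map (es_inj i) (es_inj i)) <= C ^+ 2.
  move=> vu vi; apply: IHs => //.
  - move=> j js; have ji : j != i by apply: contraNneq i_s => <-.
    by rewrite vu // u0 // inE js orbT.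
  - have : finite_set ([set j | bsl_fun u j != 0] `|` [set i]).
      by rewrite finite_setU; split => //; exact: finite_set1.
    apply: sub_finite_set => j /= vj.
    by have [->|ji] := eqVneq j i; [right|left; rewrite /= -vu].
  - by move=> j; have [->//|/vu ->] := eqVneq j i.
have n1 : nrm (1 : R[i]^o) = 1 by apply: (@nrm_real R 1).
have ui : bsl_fun u i = 0 by rewrite u0 // inE eqxx.
have hp := vP (u + unit_vec i); have hm := vP (u - unit_vec i).
set D := \sum_(i <- s) _ in hp hm *.
have {}hp : opnorm (ptens_map (es_smul (u + unit_vec i)) (es_smul (u + unit_vec i)) + D) <= C ^+ 2.
  apply: hp => [j /negPf ji|]; first by rewrite bsl_funD unit_vecE ji addr0.
  by rewrite bsl_funD unit_vecE eqxx ui add0r n1.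
have {}hm : opnorm (ptens_map (es_smul (u - unit_vec i)) (es_smul (u - unit_vec i)) + D) <= C ^+ 2.
  apply: hm => [j /negPf ji|]; first by rewrite bsl_funB unit_vecE ji subr0.
  by rewrite bsl_funB unit_vecE eqxx ui sub0r nrmN n1.
apply: opnorm_midpoint hp hm; apply: mulr2n_midpoint.
by rewrite es_smulD es_smulB ptens_map_parallelogram.
Qed.

(** A list stands for a finite subset of [I]; [undup] makes each index count once. *)
Definition diagonal (s : seq I) : blin (ptensor B B) (ptensor EB EB) :=
  \sum_(i <- undup s) ptens_map (es_inj i) (es_inj i).

Lemma opnorm_diagonal s : opnorm (diagonal s) <= C ^+ 2.
Proof.
(* Starting from the vector 0 leaves only the diagonal sum. *)
have := @opnorm_square_diagonal (undup s) 0 (undup_uniq s).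
rewrite es_smul0 (_ : ptens_map 0 0 = 0) ?add0r; last first.
  apply: blin_ext; apply: ptensor_ext => x y.
  by rewrite ptens_mapE ptens0l.
apply=> [i _||j]; first exact: bsl_fun0; last by rewrite bsl_fun0 nrm0.
apply: sub_finite_set (@finite_set0 I) => j /=.
by rewrite bsl_fun0 eqxx.
Qed.

End DiagonalBound.
End LatticeSum.

(** * A virtual diagonal of the sum as a weak-* limit *)

Section UpperBound.
Local Open Scope complex_scope.
Local Open Scope ring_scope.
Variables (R : realType) (I : choiceType) (E : banachSeqLattice R I).
Variable B : banachAlgType R.

Local Notation EB := (esum_const E B).

Definition truncation (a : EB) (s : seq I) : EB :=
  \sum_(i <- undup s) es_inj E B i (a i).

Lemma truncationE (a : EB) s j :
  truncation a s j = if j \in s then a j else 0.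
Proof.
rewrite /truncation -mem_undup -[LHS]/(es_coord E B j _) linear_sum.
rewrite (eq_bigr (fun i => if j == i then a i else 0)) => [|i _]; last exact: es_injE.
case: ifP => js; last first.
  rewrite big1_seq // => i /andP[_ i_s]; case: eqVneq => // ji.
  by rewrite -ji js in i_s.
rewrite (bigD1_seq j) ?undup_uniq //= eqxx big1 ?addr0 // => i.
by rewrite eq_sym => /negPf ->.
Qed.

Lemma bsl_approx (e : E) (d : R) : 0 < d ->
  exists2 f : E, finite_supp (bsl_fun f) & nrm (e - f) < d.
Proof.
move=> d0; have dc : (0 : R[i]) < d%:C by rewrite ltcR.
have [||f [ef ff]] := @bsl_dense R I E (ball e d%:C).
- by exists e; exact: ballxx.
- exact: ball_open.
- by exists f => //; move: ef; rewrite -ball_normE /= nrmE ltcR.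
Qed.

(** Take a finitely supported [f] close to the norm function of [a]. Once [s] contains the support
    of [f], the tail of [a] is dominated pointwise by [es_env a - f], and solidity applies. *)
Lemma truncation_cvg (a : EB) (d : R) : 0 < d ->
  exists t : seq I, forall s, {subset t <= s} -> nrm (a - truncation a s) < d.
Proof.
move=> d0; have [f ff afd] := bsl_approx (es_env a) d0.
have /finite_seqP[t tE] := ff; exists t => s ts.
apply: le_lt_trans afd; rewrite nrm_esum -lecR -!nrmE; apply: bsl_norm_le => j.
rewrite es_envE normr_id Defs.esumB truncationE; case: ifP => [_|js].
  by rewrite subrr normr0.
rewrite subr0 bsl_funB es_envE (_ : bsl_fun f j = 0) ?subr0 ?normr_id //.
apply/eqP; apply: contraFT js => fj; apply: ts.
by have : [set` t] j by rewrite -tE.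
Qed.

(** The filter of tails of the net of finite subsets of [I], ordered by inclusion. *)
Definition large_seqs : set_system (seq I) :=
  filter_from setT (fun t : seq I => [set s : seq I | {subset t <= s}]).

Lemma large_seqs_proper : ProperFilter large_seqs.
Proof.
apply: filter_from_proper => [|t _]; last by exists t => /=.
apply: filter_from_filter => [|t t' _ _]; first by exists [::].
exists (t ++ t') => // s /= ts.
by split=> i it; apply: ts; rewrite mem_cat it ?orbT.
Qed.

Variable C : R.
Hypothesis C_bound : forall e : E, finite_supp (bsl_fun e) ->
  (forall j, nrm (bsl_fun e j) <= 1) -> nrm e <= C.

Local Notation D s M := (biadjoint (diagonal E B s) M).

(** Each summand commutes with [a] separately: there [a] acts as [a i], which commutes with [M]. *)
Lemma biadjoint_diagonal_lact (M : bidual (ptensor B B)) s (a : EB) :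
  virtual_diagonal M -> biadjoint (lact a) (D s M) = biadjoint (ract a) (D s M).
Proof.
move=> [Mc _]; rewrite /diagonal biadjoint_sum !linear_sum.
apply: eq_bigr => i _.
have actM := @ptens_map_lact R B EB (es_inj E B i) (es_inj E B i) _ _
  (@es_inj_bmull _ _ E B i a).
apply: etrans (esym (biadjoint_square M actM)) _.
rewrite Mc; apply: biadjoint_square.
by apply: ptens_map_ract => x; exact: es_inj_bmulr.
Qed.

(** Both tensor factors of a summand lie in the same copy of [B], where [es_inj] is
    multiplicative. *)
Lemma biadjoint_diagonal_prod (M : bidual (ptensor B B)) s :
  biadjoint (prod_map EB) (D s M) =
  \sum_(i <- undup s) biadjoint (es_inj E B i) (biadjoint (prod_map B) M).
Proof.
rewrite /diagonal biadjoint_sum linear_sum; apply: eq_bigr => i _.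
by apply: biadjoint_square; apply: prod_map_ptens_map => x y; exact: es_inj_bmul.
Qed.

Lemma evaluation_sum (V : normedModType R[i]) (r : seq I) (v : I -> V) :
  \sum_(i <- r) evaluation (v i) = evaluation (\sum_(i <- r) v i).
Proof.
apply/esym/(big_morph (@evaluation R V)) => [x y|]; apply: blin_ext => f.
- exact: linearD.
- exact: linear0.
Qed.

(** In the [i]-th summand [a] acts as [a i], and the unit property of [M] returns [a i] itself. *)
Lemma biadjoint_diagonal_lmul (M : bidual (ptensor B B)) s (a : EB) :
  virtual_diagonal M ->
  biadjoint (lmul a) (biadjoint (prod_map EB) (D s M)) =
  evaluation (truncation a s).
Proof.
move=> [_ Mu]; rewrite biadjoint_diagonal_prod linear_sum -evaluation_sum.
apply: eq_bigr => i _; rewrite -biadjoint_evaluation.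
have [<- _] := Mu (a i); apply: biadjoint_square => x.
by apply/esym; exact: es_inj_bmull.
Qed.

Lemma biadjoint_diagonal_rmul (M : bidual (ptensor B B)) s (a : EB) :
  virtual_diagonal M ->
  biadjoint (rmul a) (biadjoint (prod_map EB) (D s M)) =
  evaluation (truncation a s).
Proof.
move=> [_ Mu]; rewrite biadjoint_diagonal_prod linear_sum -evaluation_sum.
apply: eq_bigr => i _; rewrite -biadjoint_evaluation.
have [_ ->] := Mu (a i); apply: biadjoint_square => x.
by apply/esym; exact: es_inj_bmulr.
Qed.

(** Commutation holds for every [s] and survives the limit; the unit property holds up to
    truncation, which disappears in the limit. *)
Lemma esum_virtual_diagonal (M : bidual (ptensor B B)) : virtual_diagonal M ->
  exists2 N : bidual (ptensor EB EB), virtual_diagonal N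
    & nrm N <= C ^+ 2 * nrm M.
Proof.
move=> MV.
have [U [UU large_U]] := ultraFilterLemma large_seqs_proper.
have UP : ProperFilter U by exact: ultra_proper.
have [||N NC DN] := @banach_alaoglu R _ U UU (dual (ptensor EB EB))
    (fun s => D s M) (C ^+ 2 * nrm M).
- by rewrite mulr_ge0 ?nrm_ge0 ?sqr_ge0.
- move=> s; apply: le_trans (opnorm_biadjoint_le _ _) _.
  by rewrite ler_wpM2r ?nrm_ge0 //; exact: opnorm_diagonal.
have N_eq (f g : dual (ptensor EB EB)) :
    (forall s, D s M f = D s M g) -> N f = N g.
  move=> fg; apply: (cvg_unique (@norm_hausdorff _ _) (DN f)).
  by rewrite (funext fg); exact: DN.
(* Norm convergence of truncations holds on tails of the net, which belong to [U], and [f] is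
   continuous. *)
have trunc_cvg (a : EB) (f : dual EB) :
    (fun s => f (truncation a s)) @ U --> f a.
  apply/cvgrPdist_lt => e e0.
  have er : (complex.Re e)%:C = e by rewrite RRe_real // gtr0_real.
  have r0 : 0 < complex.Re e by rewrite -ltcR er.
  have f1 : 0 < opnorm f + 1 by rewrite ltr_wpDl ?opnorm_ge0.
  have [|t tP] := @truncation_cvg a (complex.Re e / (opnorm f + 1)).
    by rewrite divr_gt0.
  apply: large_U; exists t => // s /= /tP; rewrite ltr_pdivlMr // => trunc.
  rewrite -linearB -er nrmE ltcR.
  apply: le_lt_trans (ler_opnorm _ _) _; apply: le_lt_trans trunc.
  by rewrite mulrC ler_wpM2l ?nrm_ge0 // lerDl.
have N_eval (T : blin EB EB) (a : EB) :
    (forall s, biadjoint T (biadjoint (prod_map EB) (D s M)) =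
       evaluation (truncation a s)) ->
    biadjoint T (biadjoint (prod_map EB) N) = evaluation a.
  move=> Ta; apply: blin_ext => f.
  (* Unfolding the adjoints, the left side at [f] is [N g], the limit of [D s M g]. *)
  pose g := pullback (prod_map EB) (pullback T f).
  apply: (cvg_unique (@norm_hausdorff _ _) (DN g)).
  have -> : (fun s => D s M g) = (fun s => f (truncation a s)).
    by apply: funext => s; exact: (congr1 (fun L : bidual EB => L f) (Ta s)).
  exact: trunc_cvg.
exists N => //; split=> a.
  apply: blin_ext => f; apply: N_eq => s.
  exact: (congr1 (fun L : bidual _ => L f) (biadjoint_diagonal_lact s a MV)).
split.
  by apply: N_eval => s; exact: biadjoint_diagonal_lmul.
by apply/esym/N_eval => s; exact: biadjoint_diagonal_rmul.
Qed.

Lemma amenable_esum_const : amenable B -> amenable EB.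
Proof. by move=> [M /esum_virtual_diagonal[N NV _]]; exists N. Qed.

Lemma AM_esum_const_le : 0 < C -> (AM EB <= (C ^+ 2)%:E * AM B)%E.
Proof.
(* Dividing by [C ^+ 2] leaves the bare infimum on the right, so one virtual diagonal of [B] is
   treated at a time. *)
move=> C0; rewrite -lee_pdivrMl ?exprn_gt0 //.
apply: le_ereal_inf_tmp => _ [M MV <-]; rewrite lee_pdivrMl ?exprn_gt0 //.
have [N NV NM] := esum_virtual_diagonal MV.
by apply: ge_ereal_inf; exists (nrm N)%:E; [exists N|rewrite lee_fin].
Qed.

End UpperBound.

(** * The constant of the lattice *)

Section LatticeConstant.
Local Open Scope complex_scope.
Local Open Scope ring_scope.
Variables (R : realType) (I : choiceType) (E : banachSeqLattice R I).

(** By solidity [e] is dominated by the characteristic function of its support. Thus characteristic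
    functions also control vectors of signs. *)
Lemma bsl_const_bound (C : R) : (bsl_const E <= C%:E)%E ->
  forall e : E, finite_supp (bsl_fun e) ->
  (forall j, nrm (bsl_fun e j) <= 1) -> nrm e <= C.
Proof.
move=> EC e ef e1.
have n1 : `|1 : R[i]| = 1 := normr1 _.
pose F := [set j | bsl_fun e j != 0].
have Ff : finite_supp (\1_F : I -> R[i]^o).
  apply: sub_finite_set ef => j /=; rewrite indicE.
  by case: (boolP (j \in F)) => [|_]; [rewrite inE|rewrite eqxx].
have [f fF] := bsl_c00 E Ff.
have ef_le : nrm e <= nrm f.
  rewrite -lecR -!nrmE; apply: bsl_norm_le => j; rewrite fF indicE.
  case: (boolP (j \in F)) => [_|]; first by rewrite n1 (nrmE (_ : R[i]^o)) lecR.
  by rewrite notin_setE /= => /negP; rewrite negbK => /eqP ->; rewrite normr0.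
apply: le_trans ef_le _; rewrite -lee_fin; apply: le_trans EC.
by apply: ereal_sup_ubound; exists f => //; exists F.
Qed.

(** The norm of [E] dominates the supremum norm, which is at least 1 at [unit_vec E i]. This makes
    the constant positive. *)
Lemma bsl_const_ge1 (i : I) : (1%:E <= bsl_const E)%E.
Proof.
apply: (@le_trans _ _ (nrm (unit_vec E i))%:E).
  rewrite lee_fin; apply: le_trans (nrm_bsl_fun _ i).
  by rewrite unit_vecE eqxx (@nrm_real R 1).
apply: ereal_sup_ubound; exists (unit_vec E i) => //.
exists [set i]; first exact: finite_set1.
by apply: funext => j; rewrite unit_vecE indicE in_set1.
Qed.

End LatticeConstant.

Lemma bsl_const_c0_le1 (R : realType) (I : Type) :
  (bsl_const (c0_lattice R I) <= 1%:E)%E.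
Proof.
apply: ge_ereal_sup => _ [e [F _ eF] <-]; rewrite lee_fin.
rewrite nrm_c0; apply: linf_norm_le => // j.
rewrite -[c0_fun e]/(bsl_fun (e : c0_lattice R I)) eF indicE.
by case: (j \in F); rewrite ?nrm0 // (@nrm_real R 1).
Qed.

(** * Both inequalities combined, and the case of the supremum norm *)

Section ConstantSums.
Local Open Scope ereal_scope.
Variables (R : realType) (I : choiceType) (i : I) (B : banachAlgType R).

Lemma esum_const_amenability (E : banachSeqLattice R I) : bsl_const E < +oo ->
  (amenable (esum_const E B) <-> amenable B) /\
  AM B <= AM (esum_const E B) /\
  AM (esum_const E B) <= bsl_const E ^+ 2 * AM B.
Proof.
(* The lower bound 1 rules out [-oo] and finiteness rules out [+oo], so the constant is a real
   [C]. *)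
have := bsl_const_ge1 E i; case EC : (bsl_const E) => [C| |] // C1 _.
have Cb := @bsl_const_bound _ _ E C; rewrite EC lexx in Cb.
have {}Cb := Cb isT.
have C0 : (0 < C)%R by apply: lt_le_trans ltr01 _; rewrite -lee_fin.
split; first split.
- exact: amenable_of_esum_const.
- exact: amenable_esum_const Cb.
- split; first exact: AM_le_esum_const.
  by rewrite -EFin_expe; exact: AM_esum_const_le.
Qed.

Lemma AM_c0_sum : AM (esum_const (c0_lattice R I) B) = AM B.
Proof.
apply/le_anti/andP; split; last exact: AM_le_esum_const.
(* The factor 1 is written as a square to match the upper bound with [C = 1]. *)
rewrite -[leRHS]mul1e -(expr1n _ 2).
apply: AM_esum_const_le => //.
exact/bsl_const_bound/bsl_const_c0_le1.
Qed.

End ConstantSums.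

Local Open Scope ereal_scope.

Theorem corollary5p4 (R : realType) (I : Type) (I_neq0 : [set: I] !=set0)
    (B : banachAlgType R) :
  (forall E : banachSeqLattice R I, bsl_const E < +oo ->
     (amenable (esum_const E B) <-> amenable B) /\
     AM B <= AM (esum_const E B) /\
     AM (esum_const E B) <= bsl_const E ^+ 2 * AM B) /\
  AM (esum_const (c0_lattice R I) B) = AM B.
Proof.
have [i _] := I_neq0; split=> [E Efin|].
  (* [{classic I}] equips [I] with decidable equality and choice, needed for lists of indices. *)
  exact: (@esum_const_amenability R {classic I} i B E).
exact: (@AM_c0_sum R {classic I} i B).
Qed.
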